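(* Let $G=\mathrm{Spec}(A)$ be a smooth connected affine algebraic group over $\mathbb{C}$ with Lie algebra $\mathfrak g$, let $T=\mathrm{Der}_{\mathbb C}(A)$ and $\Omega=\Omega^1_{A/\mathbb C}$, and let $(,)$ be a symmetric ad-invariant bilinear form on $\mathfrak g$. Let $j_L:\mathfrak g\to (\mathcal D^{ch}_{G;(,)})_1$ be the canonical embedding into the weight $1$ component. (i) There exists a unique embedding (injective linear map) $j_R:\mathfrak g\hookrightarrow(\mathcal D^{ch}_{G;(,)})_1$ such that (a) the composition of $j_R$ with the canonical projection $(\mathcal D^{ch}_{G;(,)})_1\to T$ is equal to $i_R$; (b) $j_L(\tau)_{(n)}j_R(\tau')=0$ for all $\tau,\tau'\in\mathfrak g$ and all $n\ge0$. (ii) For all $\tau,\tau'\in\mathfrak g$ one has $$j_R(\tau)_{(1)}j_R(\tau')=(\tau,\tau')^o\quad\text{and}\quad j_R(\tau)_{(0)}j_R(\tau')=j_R([\tau,\tau']),$$ where $(,)^o=-(,)_{(K)}-(,)$ and $(x,y)_{(K)}=\mathrm{tr}_{\mathfrak g}(\mathrm{ad}_x\,\mathrm{ad}_y)$ is the Killing form.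
   Context: Vertex algebras are $\mathbb{Z}_{\ge0}$-graded over $\mathbb C$: $V=\bigoplus_{i\ge0}V_i$, vacuum $\mathbf 1\in V_0$, translation $\partial$ of degree $1$, $x_{(n)}y\in V_{i+j-n-1}$ for $x\in V_i,y\in V_j$; scalars are identified with multiples of $\mathbf 1$. Vector fields: $i_L,i_R:\mathfrak g\hookrightarrow T$ are the two commuting Lie algebra embeddings given by left invariant and right invariant vector fields: $(i_L(x)f)(g)=\frac{d}{dt}\big|_{t=0}f(g\exp(tx))$, $(i_R(x)f)(g)=\frac{d}{dt}\big|_{t=0}f(\exp(-tx)g)$. Algebra $\mathcal D^{ch}_{G;(,)}$ (global sections over $G$): the graded vertex algebra generated by $A$ in weight $0$ and $\mathfrak g$ in weight $1$ (embedded linearly), subject only to: $1\in A$ is the vacuum; $a_{(-1)}b=ab$, $a_{(n)}b=0$ for $n\ge0$; $\tau_{(0)}a=i_L(\tau)(a)$, $\tau_{(n)}a=0$ for $n\ge1$; $\tau_{(1)}\tau'=(\tau,\tau')\mathbf 1$, $\tau_{(0)}\tau'=[\tau,\tau']$, $\tau_{(n)}\tau'=0$ for $n\ge2$ ($a,b\in A$, $\tau,\tau'\in\mathfrak g$). Its weight $0$ component is $A$, and its weight $1$ component is identified with $T\oplus\Omega$ by $(a\,i_L(\tau),\,b\,dc)\mapsto a_{(-1)}\tau+b_{(-1)}\partial c$; the canonical projection to $T$ is the projection to the first summand. The map $j_L$ sends $\tau\in\mathfrak g$ to the generator $\tau$. *)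

(* Defs.v *)
From HB Require Import structures.
From mathcomp Require Import all_boot all_order all_algebra.
From mathcomp Require Import reals complex.

Set Implicit Arguments.
Unset Strict Implicit.
Unset Printing Implicit Defensive.

Import GRing.Theory.
Local Open Scope ring_scope.

(** * Vertex algebras *)

(* The binomial coefficient m (m - 1) ... (m - j + 1) / j! for an integer m. *)
Definition binz (C : fieldType) (m : int) (j : nat) : C :=
  (\prod_(i < j) (m - i%:Z)%:~R) / (j`!)%:R.

(* Vertex algebras graded by the natural numbers. [np n x y] is x_(n) y.
   In [va_borcherds] the three families of terms vanish for large j, so the
   infinite sums of the Borcherds identity are stated as sums over j < N for
   all large N. *)
Record gradedVA (C : fieldType) := GradedVA {
  va_sort :> lmodType C;
  wt : nat -> va_sort -> Prop;
  np : int -> va_sort -> va_sort -> va_sort;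
  vac : va_sort;
  wt_lin : forall i k x y, wt i x -> wt i y -> wt i (k *: x + y);
  wt_zero : forall i, wt i 0;
  wt_span : forall x, exists N (u : nat -> va_sort),
    (forall i, wt i (u i)) /\ x = \sum_(i < N) u i;
  wt_direct : forall N (u : nat -> va_sort),
    (forall i, wt i (u i)) -> \sum_(i < N) u i = 0 ->
    forall i, (i < N)%N -> u i = 0;
  np_linl : forall n y, linear (fun x => np n x y);
  np_linr : forall n x, linear (fun y => np n x y);
  wt_vac : wt 0 vac;
  wt_np : forall i j (n : int) x y, wt i x -> wt j y ->
    match i%:Z + j%:Z - n - 1 with
    | Posz k => wt k (np n x y)
    | Negz _ => np n x y = 0
    end;
  np_vacl : forall n x, np n vac x = if n == -1 then x else 0;
  np_vacr : forall x, np (-1) x vac = x;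
  np_vacr_ge0 : forall (n : nat) x, np n%:Z x vac = 0;
  va_borcherds : forall (m n l : int) x y z, exists N0, forall N, (N0 <= N)%N ->
    \sum_(j < N) binz C m j *: np (m + l - j%:Z) (np (n + j%:Z) x y) z =
    \sum_(j < N) ((-1) ^+ j * binz C n j) *:
       (np (m + n - j%:Z) x (np (l + j%:Z) y z)
        - (-1) ^ n *: np (n + l - j%:Z) y (np (m + j%:Z) x z))
}.

Arguments wt {C V} _ _ : rename.
Arguments np {C V} _ _ _ : rename.
Arguments vac {C V} : rename.

Definition transl (C : fieldType) (V : gradedVA C) (x : V) : V := np (-2) x vac.

Definition va_hom (C : fieldType) (V W : gradedVA C) (f : V -> W) : Prop :=
  [/\ linear f,
      f vac = vac,
      forall n x y, f (np n x y) = np n (f x) (f y) &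
      forall i x, wt i x -> wt i (f x)].

(** * Affine group schemes as commutative Hopf algebras *)

Section Tensors.
Variables (C : fieldType) (A : comAlgType C).

Definition bilinear_map (M : lmodType C) (b : A -> A -> M) : Prop :=
  (forall u, linear (b u)) /\ (forall v, linear (b^~ v)).

Definition trilinear_map (M : lmodType C) (t : A -> A -> A -> M) : Prop :=
  [/\ forall u v, linear (t u v),
      forall u w, linear (fun v => t u v w) &
      forall v w, linear (fun u => t u v w)].

(* A list [:: (u1, v1); ...] represents the tensor u1 (x) v1 + ... of A (x) A;
   two lists represent the same tensor iff all bilinear maps agree on them. *)
Definition tensor_eq (s t : seq (A * A)) : Prop :=
  forall (M : lmodType C) (b : A -> A -> M), bilinear_map b ->
    \sum_(p <- s) b p.1 p.2 = \sum_(p <- t) b p.1 p.2.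

End Tensors.

(* A group scheme structure on Spec A. [comul f] represents the function
   (g, h) |-> f (g h), [counit f] is f (1), and [antipode f] is the function
   g |-> f (g^-1). *)
Record groupScheme (C : fieldType) (A : comAlgType C) := GroupScheme {
  comul : A -> seq (A * A);
  counit : {lrmorphism A -> C^o};
  antipode : {lrmorphism A -> A};
  comul_lin : forall k f h, tensor_eq (comul (k *: f + h))
    ([seq (k *: p.1, p.2) | p <- comul f] ++ comul h);
  comul_one : tensor_eq (comul 1) [:: (1, 1)];
  comul_mul : forall f h, tensor_eq (comul (f * h))
    [seq (p.1 * q.1, p.2 * q.2) | p <- comul f, q <- comul h];
  comul_coassoc : forall f (M : lmodType C) (t : A -> A -> A -> M),
    trilinear_map t ->
    \sum_(p <- comul f) \sum_(q <- comul p.1) t q.1 q.2 p.2 =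
    \sum_(p <- comul f) \sum_(q <- comul p.2) t p.1 q.1 q.2;
  counitl : forall f, \sum_(p <- comul f) (counit p.1 : C) *: p.2 = f;
  counitr : forall f, \sum_(p <- comul f) (counit p.2 : C) *: p.1 = f;
  antipodel : forall f,
    \sum_(p <- comul f) antipode p.1 * p.2 = (counit f : C)%:A;
  antipoder : forall f,
    \sum_(p <- comul f) p.1 * antipode p.2 = (counit f : C)%:A
}.

(** * Geometric conditions on Spec A *)

Section Geometry.
Variables (C : fieldType) (A : comAlgType C).

Definition finite_type : Prop :=
  exists s : seq A, forall P : A -> Prop,
    {in s, forall a, P a} -> P 1 ->
    (forall k a b, P a -> P b -> P (k *: a + b)) ->
    (forall a b, P a -> P b -> P (a * b)) ->
    forall a, P a.

(* The infinitesimal lifting property along B -> B / I with I ^ 2 = 0. *)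
Definition formally_smooth : Prop :=
  forall (B B' : comAlgType C) (pi : {lrmorphism B -> B'}),
    (forall b', exists b, pi b = b') ->
    (forall b c, pi b = 0 -> pi c = 0 -> b * c = 0) ->
    forall phi : {lrmorphism A -> B'},
    exists psi : {lrmorphism A -> B}, forall a, pi (psi a) = phi a.

(* Over a field, finite type and finite presentation agree. *)
Definition smooth : Prop := finite_type /\ formally_smooth.

Definition prime_ideal (p : A -> Prop) : Prop :=
  [/\ p 0, forall a b, p a -> p b -> p (a + b),
      forall a b, p b -> p (a * b), ~ p 1 &
      forall a b, p (a * b) -> p a \/ p b].

(* The point p lies on the Zariski closed subset V(I). *)
Definition in_zeros (I p : A -> Prop) : Prop := forall a, I a -> p a.

(* Spec A is nonempty and not a disjoint union of two nonempty closed sets. *)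
Definition spec_connected : Prop :=
  (exists p, prime_ideal p) /\
  forall I J : A -> Prop,
    (forall p, prime_ideal p -> in_zeros I p \/ in_zeros J p) ->
    (forall p, prime_ideal p -> ~ (in_zeros I p /\ in_zeros J p)) ->
    (forall p, prime_ideal p -> in_zeros I p) \/
    (forall p, prime_ideal p -> in_zeros J p).

(* Derivations of A over C with values in an A-module. *)
Definition is_derivation (M : lmodType A) (d : A -> M) : Prop :=
  (forall (k : C) a b, d (k *: a + b) = k%:A *: d a + d b) /\
  (forall a b, d (a * b) = a *: d b + b *: d a).

(* T = Der_C (A). *)
Record der := Der {
  der_fun :> A -> A;
  derP : is_derivation (der_fun : A -> A^o)
}.

(* The Kaehler differentials of A over C. *)
Record kaehler := Kaehler {
  kd_sort :> lmodType A;
  kd : A -> kd_sort;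
  kd_derivation : is_derivation kd;
  kd_universal : forall (M : lmodType A) (d : A -> M), is_derivation d ->
    exists2 phi : {linear kd_sort -> M}, (forall a, phi (kd a) = d a) &
      forall phi' : {linear kd_sort -> M},
        (forall a, phi' (kd a) = d a) -> phi' =1 phi
}.

End Geometry.

(** * The Lie algebra and the invariant vector fields *)

Section LieAlgebra.
Variables (C : fieldType) (A : comAlgType C) (G : groupScheme A).

(* Tangent vectors at 1. *)
Definition point_derivation (x : A -> C) : Prop :=
  (forall k f h, x (k *: f + h) = k * x f + x h) /\
  (forall f h, x (f * h) = (counit G f : C) * x h + x f * (counit G h : C)).

(* The tangent vector to t |-> exp (t x) at t = 0 being x,
   f (g exp (t x)) has derivative [left_field x f] at t = 0, and
   f (exp (- t x) g) has derivative [right_field x f]. *)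
Definition left_field (x : A -> C) (f : A) : A :=
  \sum_(p <- comul G f) x p.2 *: p.1.

Definition right_field (x : A -> C) (f : A) : A :=
  - \sum_(p <- comul G f) x p.1 *: p.2.

(* The tangent space at 1, with the bracket for which [left_field] is a
   morphism of Lie algebras: on an element f, the left invariant vector field
   of z takes at 1 the value z f. *)
Record lieAlgebra := LieAlgebra {
  lie_sort :> vectType C;
  tangent : lie_sort -> A -> C;
  br : lie_sort -> lie_sort -> lie_sort;
  tangent_lin : forall k x y f,
    tangent (k *: x + y) f = k * tangent x f + tangent y f;
  tangent_inj : forall x y, tangent x =1 tangent y -> x = y;
  tangentP : forall x, point_derivation (tangent x);
  tangent_surj : forall d, point_derivation d -> exists x, tangent x =1 d;
  tangent_br : forall x y f, tangent (br x y) f =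
    tangent x (left_field (tangent y) f) - tangent y (left_field (tangent x) f)
}.

Lemma left_field_der (x : A -> C) : point_derivation x ->
  is_derivation (left_field x : A -> A^o).
Proof.
case=> xlin xM; pose b (u v : A) : A := x v *: u.
have bP : bilinear_map b.
  split=> [u k v w|v k u w]; rewrite /b.
    by rewrite xlin scalerDl scalerA.
  by rewrite scalerDr !scalerA mulrC.
split=> [k f h|f h].
  rewrite /left_field (comul_lin G k f h bP) big_cat big_map /=.
  congr (_ + _); rewrite -[RHS]/(k%:A * _) mulr_algl scaler_sumr.
  by apply: eq_bigr => p _; rewrite /b /= !scalerA mulrC.
rewrite /left_field (comul_mul G f h bP) big_allpairs_dep /= /b.
rewrite -[RHS]/(f * left_field x h + h * left_field x f).
have Ef := counitr G f; have Eh := counitr G h.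
have -> : f * left_field x h =
    (\sum_(p <- comul G f) (counit G p.2 : C) *: p.1) * left_field x h.
  by rewrite Ef.
have -> : h * left_field x f = left_field x f *
    (\sum_(p <- comul G h) (counit G p.2 : C) *: p.1).
  by rewrite Eh mulrC.
rewrite /left_field !mulr_suml -big_split /=.
apply: eq_bigr => p _; rewrite !mulr_sumr -big_split /=.
apply: eq_bigr => q _; rewrite xM scalerDl.
by rewrite -!scalerAl -!scalerAr !scalerA.
Qed.

Lemma right_field_der (x : A -> C) : point_derivation x ->
  is_derivation (right_field x : A -> A^o).
Proof.
case=> xlin xM; pose b (u v : A) : A := x u *: v.
have bP : bilinear_map b.
  split=> [u k v w|v k u w]; rewrite /b.
    by rewrite scalerDr !scalerA mulrC.
  by rewrite xlin scalerDl scalerA.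
split=> [k f h|f h].
  rewrite /right_field (comul_lin G k f h bP) big_cat big_map /= opprD.
  congr (_ + _); rewrite -[RHS]/(k%:A * _) mulr_algl scalerN scaler_sumr.
  congr (- _); apply: eq_bigr => p _; rewrite /b /=.
  have := xlin k p.1 0; have := xlin 1 0 0.
  rewrite scale1r !addr0 mul1r -{1}[x 0]addr0 => /addrI <-.
  by rewrite !addr0 => ->; rewrite scalerA.
rewrite /right_field (comul_mul G f h bP) big_allpairs_dep /= /b.
rewrite -[RHS]/(f * right_field x h + h * right_field x f) /right_field.
rewrite !mulrN -opprD; congr (- _).
set H := \sum_(p <- comul G h) x p.1 *: p.2.
set F := \sum_(p <- comul G f) x p.1 *: p.2.
have -> : f * H = (\sum_(p <- comul G f) (counit G p.1 : C) *: p.2) * H.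
  by congr (_ * _); rewrite counitl.
have -> : h * F = F * (\sum_(p <- comul G h) (counit G p.1 : C) *: p.2).
  by rewrite counitl mulrC.
rewrite !mulr_suml -big_split /=.
apply: eq_bigr => p _; rewrite !mulr_sumr -big_split /=.
apply: eq_bigr => q _; rewrite xM scalerDl.
by rewrite -!scalerAl -!scalerAr !scalerA.
Qed.

Definition iL (g : lieAlgebra) (x : g) : der A :=
  Der (left_field_der (tangentP x)).

Definition iR (g : lieAlgebra) (x : g) : der A :=
  Der (right_field_der (tangentP x)).

Variable g : lieAlgebra.

Definition killing (x y : g) : C :=
  let e := vbasis {:g} in
  \sum_(i < \dim {:g}) coord e i (br x (br y e`_i)).

Record invariant_form (B : g -> g -> C) : Prop := InvariantForm {
  form_linl : forall k x y z, B (k *: x + y) z = k * B x z + B y z;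
  form_linr : forall k x y z, B x (k *: y + z) = k * B x y + B x z;
  form_sym : forall x y, B x y = B y x;
  form_inv : forall x y z, B (br x y) z = B x (br y z)
}.

(** * Chiral differential operators *)

Variable B : g -> g -> C.

Record cdo_relations (V : gradedVA C) (jA : A -> V) (j : g -> V) : Prop :=
  CdoRelations {
  rel_linA : linear jA;
  rel_wtA : forall a, wt 0 (jA a);
  rel_lin : linear j;
  rel_wt : forall x, wt 1 (j x);
  rel_vac : jA 1 = vac;
  rel_AA : forall a b, np (-1) (jA a) (jA b) = jA (a * b);
  rel_AA_ge0 : forall a b (n : nat), np n%:Z (jA a) (jA b) = 0;
  rel_gA : forall x a, np 0 (j x) (jA a) = jA (iL x a);
  rel_gA_ge1 : forall x a (n : nat), (1 <= n)%N -> np n%:Z (j x) (jA a) = 0;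
  rel_gg1 : forall x y, np 1 (j x) (j y) = B x y *: vac;
  rel_gg0 : forall x y, np 0 (j x) (j y) = j (br x y);
  rel_gg_ge2 : forall x y (n : nat), (2 <= n)%N -> np n%:Z (j x) (j y) = 0
}.

(* The graded vertex algebra presented by the generators A (weight 0) and
   g (weight 1), which embed into it, and the relations above. *)
Record cdo := Cdo {
  cdo_sort :> gradedVA C;
  jA : A -> cdo_sort;
  jL : g -> cdo_sort;
  cdo_rel : cdo_relations jA jL;
  jA_inj : injective jA;
  jL_inj : injective jL;
  cdo_universal : forall (W : gradedVA C) (kA : A -> W) (k : g -> W),
    cdo_relations kA k ->
    exists2 f : cdo_sort -> W,
      [/\ va_hom f, forall a, f (jA a) = kA a & forall x, f (jL x) = k x] &
      forall f' : cdo_sort -> W,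
        [/\ va_hom f', forall a, f' (jA a) = kA a & forall x, f' (jL x) = k x] ->
        f' =1 f
}.

(* The identification of the weight 1 component with T (+) Omega: v corresponds
   to (xi, om) when v is a sum of terms a_(-1) x and b_(-1) (transl c), xi is
   the sum of the corresponding a (iL x), and om that of the b (kd c). *)
Definition weight1_ident (Om : kaehler A) (D : cdo) (v : D)
    (xi : der A) (om : Om) : Prop :=
  exists (s : seq (A * g)) (w : seq (A * A)),
  [/\ v = \sum_(p <- s) np (-1) (jA D p.1) (jL D p.2)
        + \sum_(q <- w) np (-1) (jA D q.1) (transl (jA D q.2)),
      forall f, xi f = \sum_(p <- s) p.1 * iL p.2 f &
      om = \sum_(q <- w) q.1 *: kd Om q.2].

(* xi is the image of v under the canonical projection to T. *)
Definition canonical_proj (Om : kaehler A) (D : cdo) (v : D) (xi : der A)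
    : Prop :=
  exists om : Om, weight1_ident v xi om.

(* [canonical_proj] is single-valued because xi f is recovered from v as
   v_(0) f. *)
Lemma np0l (V : gradedVA C) n (y : V) : np n 0 y = 0.
Proof.
by have := np_linl n y 1 0 0; rewrite !scale1r !addr0 -{1}[np n 0 y]addr0 => /addrI.
Qed.

Lemma np0r (V : gradedVA C) n (x : V) : np n x 0 = 0.
Proof.
by have := np_linr n x 1 0 0; rewrite !scale1r !addr0 -{1}[np n x 0]addr0 => /addrI.
Qed.

Lemma np_assoc_nonneg (V : gradedVA C) (n : int) (k : nat) (x y z : V) :
  (forall i : nat, np i%:Z x z = 0) ->
  (forall i : nat, (k < i)%N -> np i%:Z y z = 0) ->
  np k%:Z (np n x y) z = np n x (np k%:Z y z).
Proof.
move=> xz yz; have [N0 HN] := va_borcherds 0 n k%:Z x y z.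
have := HN N0.+1 (leqnSn _); rewrite !big_ord_recl !big1.
- rewrite /binz !big_ord0 fact0 divr1 !expr0 !mulr1 !scale1r.
  by rewrite !add0r !subr0 !addr0 xz np0r scaler0 subr0.
- move=> i _; rewrite add0r xz np0r scaler0 subr0 -PoszD yz ?np0r ?scaler0 //.
  by rewrite lift0 addnS ltnS leq_addr.
- by move=> i _; rewrite /binz big_ord_recl /= subr0 !mul0r scale0r.
Qed.

Lemma canonical_proj_uniq (Om : kaehler A) (D : cdo) (v : D) (xi xi' : der A) :
  canonical_proj Om v xi -> canonical_proj Om v xi' -> xi =1 xi'.
Proof.
have H f : forall xi : der A, canonical_proj Om v xi ->
    np 0 v (jA D f) = jA D (xi f).
  move=> {xi xi'} xi [om [s [w [-> xiE _]]]]; have R := cdo_rel D.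
  have addl u u' : np 0 (u + u') (jA D f) = np 0 u (jA D f) + np 0 u' (jA D f).
    by have := np_linl 0 (jA D f) 1 u u'; rewrite !scale1r.
  have addA a a' : jA D (a + a') = jA D a + jA D a'.
    by have := rel_linA R 1 a a'; rewrite !scale1r.
  have A0 : jA D 0 = 0.
    by have := addA 0 0; rewrite addr0 -{1}[jA D 0]addr0 => /addrI.
  have Az a (i : nat) : np i%:Z (jA D a) (jA D f) = 0 by apply: rel_AA_ge0 R _ _ _.
  rewrite xiE addl.
  have -> : np 0 (\sum_(q <- w) np (-1) (jA D q.1) (transl (jA D q.2)))
              (jA D f) = 0.
    elim: w => [|q w IH]; rewrite (big_nil, big_cons) ?np0l // addl IH addr0.
    have tz (i : nat) : np i%:Z (transl (jA D q.2)) (jA D f) = 0.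
      rewrite /transl np_assoc_nonneg // => [|k _].
        by rewrite np_vacl np0r.
      by rewrite np_vacl.
    by rewrite (@np_assoc_nonneg _ (-1) 0%N) ?tz ?np0r.
  rewrite addr0; elim: s {xiE} => [|p s IH].
    by rewrite !big_nil np0l A0.
  rewrite !big_cons addl addA IH; congr (_ + _).
  rewrite (@np_assoc_nonneg _ (-1) 0%N) // => [|i i0].
    by rewrite (rel_gA R) (rel_AA R).
  exact: rel_gA_ge1 R _ _ _ i0.
by move=> /(H _) E /(H _) E' f; apply: (@jA_inj D); rewrite -E -E'.
Qed.

(* An embedding of g into the weight 1 component satisfying (a) and (b). *)
Definition is_jR (Om : kaehler A) (D : cdo) (j : {linear g -> D}) : Prop :=
  [/\ injective j,
      forall x, wt 1 (j x),
      forall x, canonical_proj Om (j x) (iR x) &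
      forall x y (n : nat), np n%:Z (jL D x) (j y) = 0].

Definition dual_form (x y : g) : C := - killing x y - B x y.

End LieAlgebra.

(* Main.v *)
Require Import Defs.
From HB Require Import structures.
From mathcomp Require Import reals complex.
From mathcomp Require Import all_boot all_order all_algebra.
From mathcomp Require Import boolp classical_sets zify ring.

(* Fix a basis e_i of g and write i_R(x) = sum_i a_i(x) i_L(e_i); here -a(x) is
   g |-> Ad(g^-1) x. Since i_L and i_R commute, i_L(y) a_i(x) is given by the
   bracket. The forms w_i dual to the i_L(e_i) are a frame of the one-forms. An
   element of weight 1 over i_R(x) is sum_i a_i(x) e_i + w for a one-form w. It
   is killed by j_L(y)_(1) iff the contraction of w with i_L(y) is
   sum_l (y, e_l)^o a_l(x); the Killing form comes from the divergence
   sum_i i_L(e_i) i_L(y) a_i(x). This determines w, and invariance of (,)^o shows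
   that j_L(y)_(0) kills the sum as well.

   By uniqueness, j_R(x)_(0) j_R(y) = j_R([x, y]), both sides lying over
   i_R([x, y]) and commuting with j_L. The function j_R(x)_(1) j_R(y) is killed
   by all left invariant fields, hence is constant because G is connected, and
   its value at 1 is (x, y)^o.

   That a function f killed by all left invariant fields is constant is shown as
   follows. If f(1) = 0, the Euler field at 1 shows that f lies in all powers of
   the maximal ideal of 1, so f vanishes near 1 by Krull's intersection theorem.
   Translating, the zero set of all such functions is open as well as closed. *)

Set Implicit Arguments.
Unset Strict Implicit.
Unset Printing Implicit Defensive.

Import GRing.Theory.
Local Open Scope ring_scope.

(** * Commutative algebra *)

(** Zorn's lemma above a given member [W], with stability under unions asked for nonempty chains
    only. *)
Lemma maximal_superset (T : Type) (P : (T -> Prop) -> Prop) (W : T -> Prop) :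
  P W ->
  (forall F : (T -> Prop) -> Prop, (exists X, F X) ->
     (forall X, F X -> P X /\ (forall x, W x -> X x)) ->
     (forall X Y, F X -> F Y -> (forall x, X x -> Y x) \/ (forall x, Y x -> X x)) ->
     P (fun x => exists2 X, F X & X x)) ->
  exists Q, [/\ P Q, forall x, W x -> Q x &
    forall Q', P Q' -> (forall x, Q x -> Q' x) -> forall x, Q' x -> Q x].
Proof.
move=> PW chainP.
pose PP (X : set T) := X = set0 \/ (P X /\ (forall x, W x -> X x)).
have [|Q [PQ maxQ]] := @Zorn_bigcup T PP.
  move=> F FP Ftot; pose F' (X : T -> Prop) := F X /\ P X /\ (forall x, W x -> X x).
  have [[X FX]|noF'] := pselect (exists X, F' X); last first.
    left; apply/seteqP; split=> // x [X FX Xx].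
    have [X0|PX] := FP _ FX; first by rewrite X0 in Xx.
    by case: noF'; exists X; split.
  right.
  have -> : bigcup F id = (fun x => exists2 X, F' X & X x) :> set T.
    apply/seteqP; split=> x [Y FY Yx]; last by exists Y => //; case: FY.
    exists Y => //; split=> //; case: (FP _ FY) => // Y0.
    by rewrite Y0 in Yx.
  split; last by move=> x Wx; exists X => //; apply: FX.2.2.
  apply: chainP; first by exists X.
    by move=> Y [].
  by move=> Y Z [FY _] [FZ _]; apply: Ftot.
have PWW : PP W by right.
have [PQ' WQ] : P Q /\ forall x, W x -> Q x.
  case: PQ => // Q0; have [WE|nWE] := pselect (forall x, ~ W x).
    have <- : W = Q by rewrite Q0; apply/seteqP; split=> x // /WE.
    by split.
  have [w Ww] : exists w, W w 
    by apply: contrapT => nW; apply: nWE => x Wx; apply: nW; exists x.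
  case: (maxQ W) => //; rewrite Q0; split=> // /(_ w Ww).
exists Q; split=> // Q' PQ'' QQ' x Q'x; apply: contrapT => nQx.
apply: (maxQ Q'); last by right; split=> // y /WQ /QQ'.
by split=> // /(_ x Q'x).
Qed.

(** * Functionals separating a vector from a subspace *)

Section Functionals.
Variables (C : fieldType) (V : lmodType C).

Definition subspace (W : V -> Prop) : Prop :=
  W 0 /\ forall k x y, W x -> W y -> W (k *: x + y).

Lemma subspaceZ W k x : subspace W -> W x -> W (k *: x).
Proof. by case=> W0 WL Wx; rewrite -[_ *: _]addr0; apply: WL. Qed.

Lemma subspaceB W x y : subspace W -> W x -> W y -> W (x - y).
Proof. by case=> W0 WL Wx Wy; rewrite addrC -scaleN1r; apply: WL. Qed.

Lemma subspaceD W x y : subspace W -> W x -> W y -> W (x + y).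
Proof. by case=> W0 WL Wx Wy; rewrite -[x]scale1r; apply: WL. Qed.

(* A maximal subspace among those avoiding [u] is a hyperplane. *)
Lemma separating_functional (W : V -> Prop) (u : V) : subspace W -> ~ W u ->
  exists lam : {scalar V}, (forall x, W x -> lam x = 0) /\ lam u = 1.
Proof.
move=> Wsub Wu; pose P X := subspace X /\ ~ X u.
have [||Q [[Qsub Qu] WQ maxQ]] := @maximal_superset V P W.
- by [].
- move=> F [X0 FX0] FP Ftot; split; last by case=> X /FP [[_]].
  split; first by exists X0 => //; case: (FP _ FX0) => [[[]]].
  move=> k x y [X FX Xx] [Y FY Yy].
  have [XY|YX] := Ftot _ _ FX FY.
    by exists Y => //; apply: (FP _ FY).1.1.2 => //; apply: XY.
  by exists X => //; apply: (FP _ FX).1.1.2 => //; apply: YX.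
(* If [Q + C x] contains [u], solving for [x] gives [c]. If not, maximality puts [x] in [Q] and
   [c = 0] serves. *)
have coef x : exists c : C, Q (x - c *: u).
  apply: contrapT => nc.
  pose Q' y := exists c : C, Q (y - c *: x).
  have Q'sub : subspace Q'.
    split; first by exists 0; rewrite scale0r subr0; apply: Qsub.1.
    move=> k y z [c Qc] [d Qd]; exists (k * c + d).
    have -> : k *: y + z - (k * c + d) *: x = k *: (y - c *: x) + (z - d *: x).
      by rewrite scalerBr scalerDl scalerA opprD addrACA.
    exact: Qsub.2.
  have Q'x : Q' x by exists 1; rewrite scale1r subrr; apply: Qsub.1.
  have QQ' y : Q y -> Q' y by exists 0; rewrite scale0r subr0.
  have [[c Qc]|nQ'u] := pselect (Q' u).
    have [c0|c0] := eqVneq c 0; first by apply: Qu; rewrite c0 scale0r subr0 in Qc.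
    apply: nc; exists c^-1.
    have := subspaceZ (- c^-1) Qsub Qc.
    by rewrite scalerBr scalerA mulNr mulVf // !scaleNr scale1r opprK addrC.
  have /(_ _ Q'x) Qx : forall x, Q' x -> Q x by apply: maxQ.
  by apply: nc; exists 0; rewrite scale0r subr0.
have coef_uniq x c d : Q (x - c *: u) -> Q (x - d *: u) -> c = d.
  move=> Qc Qd; apply/eqP; rewrite -subr_eq0; apply/negPn/negP => cd.
  have := subspaceB Qsub Qd Qc.
  have -> : x - d *: u - (x - c *: u) = (c - d) *: u.
    by rewrite opprB addrC addrA subrK scalerBl.
  move=> /(subspaceZ (c - d)^-1 Qsub); rewrite scalerA mulVf // scale1r.
  exact: Qu.
pose lam x := sval (cid (coef x)).
have lamP x : Q (x - lam x *: u) by rewrite /lam; case: (cid _).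
have lamL : linear_for *%R lam.
  move=> k x y; apply: (@coef_uniq (k *: x + y)) => //.
  rewrite scalerDl -scalerA opprD addrACA -scalerBr.
  exact: Qsub.2.
pose L := GRing.isLinear.Build C V C *%R lam lamL.
pose lam' : {scalar V} := HB.pack lam L.
exists lam'; split=> [x Wx|].
  by apply: (@coef_uniq x) (lamP x) _; rewrite scale0r subr0; apply: WQ.
by apply: (@coef_uniq u) (lamP u) _; rewrite scale1r subrr; apply: Qsub.1.
Qed.

End Functionals.

(** * Noetherian rings and Hilbert's basis theorem *)

Section Ideals.
Variable R : comNzRingType.

Definition is_ideal (I : R -> Prop) : Prop :=
  [/\ I 0, forall x y, I x -> I y -> I (x + y) & forall a x, I x -> I (a * x)].

Lemma ideal_sum (I : R -> Prop) (J : eqType) (r : seq J) (F : J -> R) :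
  is_ideal I -> (forall j, j \in r -> I (F j)) -> I (\sum_(j <- r) F j).
Proof.
case=> I0 ID _ IF; rewrite big_seq; by elim/big_ind: _ => // j /IF.
Qed.

Lemma idealB (I : R -> Prop) x y : is_ideal I -> I x -> I y -> I (x - y).
Proof. by case=> _ ID IM Ix Iy; apply: ID => //; rewrite -mulN1r; apply: IM. Qed.

Lemma idealMl (I : R -> Prop) x y : is_ideal I -> I x -> I (x * y).
Proof. by case=> _ _ IM Ix; rewrite mulrC; apply: IM. Qed.

Definition comb (s : seq R) (x : R) : Prop :=
  exists c : nat -> R, x = \sum_(i < size s) c i * s`_i.

Lemma comb_ideal s : is_ideal (comb s).
Proof.
split; first by exists (fun=> 0); rewrite big1 // => i _; rewrite mul0r.
  move=> x y [c ->] [d ->]; exists (fun i => c i + d i).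
  by rewrite -big_split; apply: eq_bigr => i _; rewrite mulrDl.
move=> a x [c ->]; exists (fun i => a * c i).
by rewrite mulr_sumr; apply: eq_bigr => i _; rewrite mulrA.
Qed.

Lemma comb_mem s x : x \in s -> comb s x.
Proof.
move=> xs; exists (fun i => (i == index x s)%:R).
have lt : (index x s < size s)%N by rewrite index_mem.
rewrite (bigD1 (Ordinal lt)) //= eqxx mul1r nth_index // big1 ?addr0 // => i ni.
suff /negPf -> : val i != index x s by rewrite mul0r.
by apply: contraNneq ni => e; apply/eqP/val_inj.
Qed.

Lemma comb_in_ideal s x (I : R -> Prop) :
  is_ideal I -> (forall y, y \in s -> I y) -> comb s x -> I x.
Proof.
move=> II sI [c ->]; apply: ideal_sum => // i _; case: II => _ _; apply.
by apply: sI; apply: mem_nth.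
Qed.

Lemma comb_prefix (g : nat -> R) m n x : (m <= n)%N ->
  comb (mkseq g m) x -> comb (mkseq g n) x.
Proof.
move=> mn; apply: comb_in_ideal; first exact: comb_ideal.
move=> y /mapP [j]; rewrite mem_iota add0n => /andP [_ im] ->.
by apply/comb_mem/map_f; rewrite mem_iota (leq_trans im).
Qed.

(* This form of the ascending chain condition needs no ideals, and passes to
   quotients at once. *)
Definition noetherian : Prop :=
  forall f : nat -> R, exists n, comb (mkseq f n) (f n).

End Ideals.

(** Dependent choice: each term is chosen in view of the list of all earlier ones, which [G]
    accumulates. *)
Lemma greedy_sequence (T : Type) (Q : seq T -> T -> Prop) :
  (forall s, exists x, Q s x) ->
  exists g : nat -> T, forall n, Q (mkseq g n) (g n).
Proof.
move=> exQ; pose h s := sval (cid (exQ s)).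
have hP s : Q s (h s) by rewrite /h; case: (cid _).
pose G := fix G n := if n is n'.+1 then rcons (G n') (h (G n')) else [::].
exists (fun n => h (G n)) => n.
suff -> : mkseq (fun n => h (G n)) n = G n by [].
by elim: n => // n IH; rewrite mkseqS IH.
Qed.

(** Otherwise one could forever pick an element of [P] outside the ideal generated by the earlier
    picks. *)
Lemma noetherian_fg (R : comNzRingType) (P : R -> Prop) : noetherian R ->
  exists s, (forall x, x \in s -> P x) /\ (forall x, P x -> comb s x).
Proof.
move=> noeth; apply: contrapT => nfg.
have [|g gP] := @greedy_sequence _
    (fun s x => (forall y, y \in s -> P y) -> P x /\ ~ comb s x).
  move=> s; apply: contrapT => nx; apply: nfg; exists s; split=> [y ys|x Px].
    by apply: contrapT => nPy; apply: nx; exists 0 => /(_ y ys).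
  by apply: contrapT => ncx; apply: nx; exists x.
have Pg n : P (g n).
  elim/ltn_ind: n => n IH; apply: (gP n _).1 => y /mapP [j].
  by rewrite mem_iota add0n => /andP [_ /IH Pi] ->.
have [n] := noeth g; apply: (gP n _).2 => y /mapP [i _ ->]; exact: Pg.
Qed.

Lemma noetherian_field (C : fieldType) : noetherian C.
Proof.
move=> f; have [f0|f0] := eqVneq (f 0) 0.
  by exists 0; rewrite f0; have [] := comb_ideal (mkseq f 0).
exists 1; have [_ _] := comb_ideal (mkseq f 1); move/(_ (f 1%N / f 0)).
move/(_ (f 0)); rewrite -mulrA mulVf // mulr1; apply.
by apply: comb_mem; rewrite mem_head.
Qed.

Lemma noetherian_surj (R S : comNzRingType) (phi : {rmorphism R -> S}) :
  (forall y, exists x, phi x = y) -> noetherian R -> noetherian S.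
Proof.
move=> surj noeth f; have [h hP] := choice (fun n => surj (f n)).
have [n [c hn]] := noeth h; exists n, (fun i => phi (c i)).
move: hn; rewrite !size_mkseq -hP => ->; rewrite rmorph_sum; apply: eq_bigr => i _.
by rewrite rmorphM !nth_mkseq // hP.
Qed.

(** From a bad sequence [f], choose [g n] of least size in the ideal [I] of all terms of [f] but
    outside the ideal of the earlier [g i]. The chain condition on leading coefficients then yields
    an element of smaller size with the same property. *)
Theorem hilbert_basis (R : comNzRingType) : noetherian R -> noetherian {poly R}.
Proof.
move=> noeth f; apply: contrapT => nf.
have {}nf n : ~ comb (mkseq f n) (f n) by move=> fn; apply: nf; exists n.
pose I x := exists n, comb (mkseq f n) x.
pose Q (s : seq {poly R}) x := (forall y, y \in s -> I y) ->
  [/\ I x, ~ comb s x & forall y, I y -> ~ comb s y -> (size x <= size y)%N].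
have [|g gP] := @greedy_sequence _ Q.
  move=> s; have [sI|nsI] := pselect (forall y, y \in s -> I y); last first.
    by exists 0 => /nsI.
  have [M sM] : exists M, forall y, y \in s -> comb (mkseq f M) y.
    elim: s sI => [|y s IH] sI; first by exists 0%N.
    have [M1 yM1] := sI y (mem_head _ _).
    have [z zs|M2 sM2] := IH; first by apply: sI; rewrite inE zs orbT.
    exists (maxn M1 M2) => z; rewrite inE => /predU1P [->|/sM2].
      exact: comb_prefix (leq_maxl _ _) yM1.
    exact: comb_prefix (leq_maxr _ _).
  (* The list [s] lies in the ideal of the first [M] terms of [f], which misses [f M]; so candidates
     outside the ideal of [s] exist. *)
  have fM : ~ comb s (f M).
    by move=> fMs; apply: (nf M); apply: comb_in_ideal fMs => //; apply: comb_ideal.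
  have IfM : I (f M).
    exists M.+1; apply/comb_mem/map_f; rewrite mem_iota; exact: leqnn.
  pose szs k := `[< exists x, [/\ I x, ~ comb s x & size x = k] >].
  have exk : exists k, szs k by exists (size (f M)); apply/asboolP; exists (f M).
  have [k /asboolP [x [Ix nx <-]] kmin] := ex_minnP exk.
  exists x => _; split=> // y Iy ny; apply: kmin; apply/asboolP; by exists y.
have Ig n : I (g n).
  elim/ltn_ind: n => n IH; have [|//] := gP n => y /mapP [j].
  by rewrite mem_iota add0n => /andP [_ /IH Pi] ->.
have ng n : ~ comb (mkseq g n) (g n).
  by have [|//] := gP n => y /mapP [i _ ->].
have ming n y : I y -> ~ comb (mkseq g n) y -> (size (g n) <= size y)%N.
  by have [|_ _] := gP n; [move=> z /mapP [i _ ->]|apply].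
have [n [c lcn]] := noeth (fun n => lead_coef (g n)).
have g0 i : (0 < size (g i))%N.
  rewrite size_poly_gt0; apply/eqP => gi0; apply: (ng i); rewrite gi0.
  by have [] := comb_ideal (mkseq g i).
have le_size (i : 'I_n) : (size (g i) <= size (g n))%N.
  by apply: ming => // gn; apply: (ng n); apply: comb_prefix gn; apply: ltnW.
(* Each [g i] is shifted to the degree of [g n], so that [k] has the same leading term as [g n]. *)
pose k := \sum_(i < n) (c i *: 'X^(size (g n) - size (g i))) * g i.
have Ck : comb (mkseq g n) k.
  exists (fun i => c i *: 'X^(size (g n) - size (g i))); rewrite size_mkseq.
  by apply: eq_bigr => i _; rewrite nth_mkseq.
have [Nk IkN] : I k.
  rewrite /k; elim/big_ind: _.
  - by exists 0%N; have [] := comb_ideal (mkseq f 0).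
  - move=> x y [m xm] [p yp]; exists (maxn m p).
    have [_ D _] := comb_ideal (mkseq f (maxn m p)); apply: D.
      exact: comb_prefix (leq_maxl _ _) xm.
    exact: comb_prefix (leq_maxr _ _) yp.
  - move=> i _; have [m xm] := Ig i; exists m.
    by have [_ _] := comb_ideal (mkseq f m); apply.
have Ih : I (g n - k).
  have [m xm] := Ig n; exists (maxn m Nk); apply: idealB; first exact: comb_ideal.
    exact: comb_prefix (leq_maxl _ _) xm.
  exact: comb_prefix (leq_maxr _ _) IkN.
have nh : ~ comb (mkseq g n) (g n - k).
  move=> hC; apply: (ng n); rewrite -[g n](subrK k).
  by have [_ D _] := comb_ideal (mkseq g n); apply: D.
have := ming n _ Ih nh; apply/negP; rewrite -ltnNge.
have -> : size (g n) = (size (g n)).-1.+1 by rewrite prednK.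
rewrite ltnS; apply/leq_sizeP => j jn; rewrite coefB /k coef_sum.
have cE (i : 'I_n) : (c i *: 'X^(size (g n) - size (g i)) * g i)`_j =
    c i * (g i)`_(j - (size (g n) - size (g i))).
  rewrite -scalerAl coefZ coefXnM ltnNge (leq_trans _ jn) //.
  by have := le_size i; have := g0 i; move: (size _) (size _) => a b; lia.
under eq_bigr => i _ do rewrite cE.
(* In the top degree the coefficients cancel by the choice of [c]; above it they all vanish. *)
have [jE|jn'] := eqVneq j (size (g n)).-1.
  move: lcn; rewrite size_mkseq [in X in X = _]/lead_coef -jE => ->.
  apply/eqP; rewrite subr_eq0; apply/eqP; apply: eq_bigr => i _.
  rewrite nth_mkseq // /lead_coef jE; congr (_ * _`_ _).
  by have := le_size i; have := g0 i; have := g0 n; move: (size _) (size _) => a b; lia.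
have {jn'}jn : (size (g n) <= j)%N.
  by move: jn; rewrite leq_eqVlt eq_sym (negPf jn') /= prednK.
rewrite nth_default // big1 ?subr0 // => i _; rewrite nth_default ?mulr0 //.
by rewrite leq_subRL ?subnK // (leq_trans (leq_subr _ _)).
Qed.

(** [A] is a quotient of an iterated polynomial ring over [C], with one variable adjoined for each
    generator. *)
Lemma finite_type_noetherian (C : fieldType) (A : comAlgType C) :
  finite_type A -> noetherian A.
Proof.
case=> s genA.
have [P [phi [noethP phiC phis]]] : exists (P : comNzRingType)
    (phi : {rmorphism P -> A}), [/\ noetherian P,
      forall k : C, exists x, phi x = k%:A & forall a, a \in s -> exists x, phi x = a].
  elim: s {genA} => [|a s [P [phi [noethP phiC phis]]]].
    exists C, (in_alg A); split=> // [|k]; first exact: noetherian_field.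
    by exists k.
  have cfu : commr_rmorph phi a by move=> x; apply: mulrC.
  exists {poly P}, (horner_morph cfu); split=> [|k|b].
  - exact: hilbert_basis.
  - by have [x <-] := phiC k; exists x%:P; apply: horner_morphC.
  rewrite inE => /predU1P [->|/phis [x <-]].
    by exists 'X; apply: horner_morphX.
  by exists x%:P; apply: horner_morphC.
apply: (@noetherian_surj P A phi) => //.
apply: genA => [//||k a b [x <-] [y <-]|a b [x <-] [y <-]].
- by exists 1; rewrite rmorph1.
- have [z kz] := phiC k; exists (z * x + y).
  by rewrite rmorphD rmorphM kz mulr_algl.
- by exists (x * y); rewrite rmorphM.
Qed.

(** * Powers of an ideal and Krull's intersection theorem *)

Section CommutativeAlgebra.
Variable R : comNzRingType.
Implicit Types m Q : R -> Prop.

Inductive ideal_pow m : nat -> R -> Prop :=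
| ideal_powT x : ideal_pow m 0 x
| ideal_powM n a b : m a -> ideal_pow m n b -> ideal_pow m n.+1 (a * b)
| ideal_powD n a b : ideal_pow m n a -> ideal_pow m n b -> ideal_pow m n (a + b)
| ideal_pow0 n : ideal_pow m n 0.

Lemma ideal_pow_ideal m n : is_ideal (ideal_pow m n).
Proof.
split=> [|x y|c x]; [exact: ideal_pow0|exact: ideal_powD|].
elim=> {n x} [x|n a b ma mb IH|n a b _ IHa _ IHb|n].
- exact: ideal_powT.
- by rewrite mulrCA; apply: ideal_powM.
- by rewrite mulrDr; apply: ideal_powD.
- by rewrite mulr0; apply: ideal_pow0.
Qed.

Lemma ideal_powMM m n p x y :
  ideal_pow m n x -> ideal_pow m p y -> ideal_pow m (n + p) (x * y).
Proof.
move=> mx my; elim: mx => {n x} [x|n a b ma mb IH|n a b _ IHa _ IHb|n].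
- by have [_ _] := ideal_pow_ideal m p; apply.
- by rewrite addSn -mulrA; apply: ideal_powM.
- by rewrite mulrDl; apply: ideal_powD.
- by rewrite mul0r; apply: ideal_pow0.
Qed.

(** The n-th power is generated by the n-fold products of generators. The factor [c] collects the
    generators already split off in the induction. *)
Lemma ideal_pow_prods m (s : seq R) n x :
    (forall a, m a -> comb s a) -> ideal_pow m n x ->
  forall Q c, is_ideal Q ->
    (forall l, all [in s] l -> size l = n -> Q (c * \prod_(t <- l) t)) -> Q (c * x).
Proof.
move=> ms mx Q + QI.
elim: mx => {n x} [x|n a b ma mb IH|n a b _ IHa _ IHb|n] c Ql.
- apply: idealMl => //; have := Ql [::] isT erefl; by rewrite big_nil mulr1.
- have [d ->] := ms _ ma; rewrite mulr_suml mulr_sumr; apply: ideal_sum => // i _.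
  have -> : c * (d i * s`_i * b) = d i * (c * s`_i * b).
    by rewrite !mulrA [c * d i]mulrC.
  case: (QI) => _ _; apply; apply: IH => l ls ln.
  have := Ql (s`_i :: l); rewrite /= mem_nth // ls ln big_cons mulrA.
  exact.
- by rewrite mulrDr; case: (QI) => _ D _; apply: D; [apply: IHa|apply: IHb].
- by rewrite mulr0; case: QI.
Qed.

(** Pigeonhole: a product of [k + n] factors contains [t] at least [k] times, or has more than [n]
    factors from the rest of the list. *)
Lemma prods_nilpotent (s : seq R) Q : is_ideal Q ->
    (forall t, t \in s -> exists k, Q (t ^+ k)) ->
  exists n, forall l, all [in s] l -> (n <= size l)%N -> Q (\prod_(t <- l) t).
Proof.
move=> QI; elim: s => [|t s IH] nilp.
  by exists 1%N => -[|x l].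
have [k tk] := nilp t (mem_head _ _).
have [u us|n Qn] := IH; first by apply: nilp; rewrite inE us orbT.
exists (k + n)%N => l ls ln; rewrite (bigID (pred1 t)) /=.
rewrite -big_filter -[X in _ * X]big_filter.
set l1 := filter _ l; set l2 := filter _ l.
have sz : (size l1 + size l2 = size l)%N.
  by rewrite !size_filter count_predC.
have -> : \prod_(i <- l1) i = t ^+ size l1.
  have : all (pred1 t) l1 by apply: filter_all.
  elim: l1 {sz} => [|x l1 IHl]; rewrite ?big_nil //= big_cons exprS.
  by move=> /andP [/eqP -> /IHl ->].
have [kl|kl] := leqP k (size l1).
  by rewrite -(subnK kl) exprD; apply: idealMl => //; case: QI => _ _; apply.
case: (QI) => _ _; apply; apply: Qn; last by lia.
apply/allP => x; rewrite mem_filter => /andP [xt /(allP ls)].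
by rewrite inE (negPf xt).
Qed.

(* An ideal [Q] that is maximal such that [Q] and [f R] meet in [m f] contains a
   power of each element of [m]: if the annihilators of the [t ^+ k] modulo [Q]
   are stationary at [k], then [Q + t ^+ k R] and [f R] meet in [m f] too. *)
Lemma krull_intersection m f : noetherian R -> is_ideal m ->
  (forall n, ideal_pow m n f) -> exists2 a, m a & f = a * f.
Proof.
move=> noeth mI mf.
pose mfI x := exists2 a, m a & x = a * f.
pose P Q := is_ideal Q /\ forall b, Q (b * f) -> mfI (b * f).
have mfI_ideal : is_ideal mfI.
  case: mI => m0 mD mM; split; first by exists 0; rewrite ?mul0r.
    by move=> _ _ [a ma ->] [b mb ->]; exists (a + b); rewrite ?mulrDl //; apply: mD.
  by move=> c _ [a ma ->]; exists (c * a); rewrite ?mulrA //; apply: mM.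
have [||Q [[QI Qf] mfQ maxQ]] := @maximal_superset R P mfI.
- by split.
- move=> F [X0 FX0] FP Ftot; split; last by move=> b [X /FP [[_ Xf] _] /Xf].
  split; first by exists X0 => //; case: (FP _ FX0) => [[[]]].
    move=> x y [X FX Xx] [Y FY Yy]; have [XY|YX] := Ftot _ _ FX FY.
      by exists Y => //; case: (FP _ FY) => [[[_ D _] _] _]; apply: D => //; apply: XY.
    by exists X => //; case: (FP _ FX) => [[[_ D _] _] _]; apply: D => //; apply: YX.
  by move=> a x [X FX Xx]; exists X => //; case: (FP _ FX) => [[[_ _ M] _] _]; apply: M.
have nilp t : m t -> exists k, Q (t ^+ k).
  move=> mt; have [k kP] : exists k, forall b, Q (t ^+ k.+1 * b) -> Q (t ^+ k * b).
    apply: contrapT => nk.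
    (* For [i < n] the witness [b i] is killed modulo [Q] by [t ^+ n], hence so is [b n] once it is
       a combination of these, a contradiction. *)
    have bad k : exists b, Q (t ^+ k.+1 * b) /\ ~ Q (t ^+ k * b).
      apply: contrapT => nb; apply: nk; exists k => b Qb; apply: contrapT => nQ.
      by apply: nb; exists b.
    have [b bP] := choice bad; have [n [c bn]] := noeth b.
    apply: (bP n).2; rewrite bn size_mkseq mulr_sumr; apply: ideal_sum => // i _.
    rewrite nth_mkseq // mulrCA; case: (QI) => _ _ QM; apply: (QM).
    have -> : t ^+ n = t ^+ (n - i.+1) * t ^+ i.+1 by rewrite -exprD subnK.
    by rewrite -mulrA; apply: QM; apply: (bP i).1.
  exists k; pose Q' x := exists b q, Q q /\ x = t ^+ k * b + q.
  have Q'I : is_ideal Q'.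
    case: (QI) => Q0 QD QM; split; first by exists 0, 0; rewrite mulr0 addr0.
      move=> _ _ [b [q [Qq ->]]] [b' [q' [Qq' ->]]]; exists (b + b'), (q + q').
      by split; [apply: QD|rewrite mulrDr addrACA].
    move=> a _ [b [q [Qq ->]]]; exists (a * b), (a * q).
    by split; [apply: QM|rewrite mulrDr mulrCA].
  have QQ' x : Q x -> Q' x by move=> Qx; exists 0, x; rewrite mulr0 add0r.
  have Q't : Q' (t ^+ k) by exists 1, 0; rewrite mulr1 addr0; case: QI.
  suff /maxQ/(_ QQ' _ Q't) : P Q' by [].
  split=> // y [b [q [Qq yE]]]; apply: Qf; rewrite yE.
  case: (QI) => _ QD QM; apply: QD => //; apply: kP.
  (* Here [t * y * f] lies in [m f], hence in [Q]; so [t ^+ k.+1 * b] is in [Q], and by the choice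
     of [k] so is [t ^+ k * b]. *)
  have -> : t ^+ k.+1 * b = t * y * f - t * q.
    by rewrite -mulrA yE mulrDr addrK exprS -mulrA.
  apply: idealB => //; last exact: QM.
  by apply: mfQ; exists (t * y); rewrite // mulrC; case: mI => _ _; apply.
have [s [sm ms]] := noetherian_fg m noeth.
have [n Qn] : exists n, forall l, all [in s] l -> (n <= size l)%N -> Q (\prod_(t <- l) t).
  by apply: prods_nilpotent => // t /sm /nilp.
have Qf1 : Q (1 * f).
  apply: (ideal_pow_prods ms (mf n)) => // l ls ln.
  by rewrite mul1r; apply: Qn; rewrite ?ln.
by have [a ma] := Qf _ Qf1; rewrite mul1r; exists a.
Qed.

End CommutativeAlgebra.

(** If [u] were not a unit, an ideal maximal among the proper ones containing [u] would be prime. *)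
Lemma unit_of_no_prime (C : fieldType) (A : comAlgType C) (u : A) :
  (forall p, prime_ideal p -> ~ p u) -> exists w, u * w = 1.
Proof.
move=> nprime; apply: contrapT => nunit.
pose P Q := is_ideal Q /\ ~ Q (1 : A); pose W x := exists w : A, x = u * w.
have [||Q [[QI Q1] WQ maxQ]] := @maximal_superset A P W.
- split; last by case=> w /esym uw; apply: nunit; exists w.
  split; first by exists 0; rewrite mulr0.
    by move=> _ _ [w ->] [w' ->]; exists (w + w'); rewrite mulrDr.
  by move=> a _ [w ->]; exists (a * w); rewrite mulrCA.
- move=> F [X0 FX0] FP Ftot; split; last by case=> X /FP [[_]].
  split; first by exists X0 => //; case: (FP _ FX0) => [[[]]].
    move=> x y [X FX Xx] [Y FY Yy]; have [XY|YX] := Ftot _ _ FX FY.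
      by exists Y => //; case: (FP _ FY) => [[[_ D _] _] _]; apply: D => //; apply: XY.
    by exists X => //; case: (FP _ FX) => [[[_ D _] _] _]; apply: D => //; apply: YX.
  by move=> a x [X FX Xx]; exists X => //; case: (FP _ FX) => [[[_ _ M] _] _]; apply: M.
have inv a : ~ Q a -> exists b q, Q q /\ 1 = a * b + q.
  move=> nQa; pose Q' x := exists b q, Q q /\ x = a * b + q.
  apply: contrapT => nQ'1; apply: nQa.
  have QQ' x : Q x -> Q' x by move=> Qx; exists 0, x; rewrite mulr0 add0r.
  case: (QI) => Q0 QD QM.
  have Q'a : Q' a by exists 1, 0; rewrite mulr1 addr0.
  apply: maxQ Q'a => //; split=> //; split; first exact: QQ'.
    move=> _ _ [b [q [Qq ->]]] [b' [q' [Qq' ->]]]; exists (b + b'), (q + q').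
    by split; [apply: QD|rewrite mulrDr addrACA].
  move=> c _ [b [q [Qq ->]]]; exists (c * b), (c * q).
  by split; [apply: QM|rewrite mulrDr mulrCA].
apply: (nprime Q); last by apply: WQ; exists 1; rewrite mulr1.
case: (QI) => Q0 QD QM; split=> // a b Qab.
apply: contrapT => nab; apply: Q1.
have [c [q [Qq ->]]] : exists c q, Q q /\ 1 = a * c + q.
  by apply: inv => Qa; apply: nab; left.
apply: (QD) => //; apply: idealMl => //.
have [d [r [Qr E]]] : exists d r, Q r /\ 1 = b * d + r.
  by apply: inv => Qb; apply: nab; right.
rewrite -[a]mulr1 E mulrDr mulrA; apply: QD.
  exact: idealMl.
exact: QM.
Qed.

(** * Invariant vector fields *)

Section UnbundledLinear.
Variables (C : fieldType) (U V : lmodType C) (f : U -> V).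
Hypothesis lf : linear f.

Let F : {linear U -> V} :=
  HB.pack f (GRing.isLinear.Build C U V *:%R f lf).

Lemma lin0 : f 0 = 0. Proof. exact: linear0 F. Qed.
Lemma linN x : f (- x) = - f x. Proof. exact: linearN F x. Qed.
Lemma linD x y : f (x + y) = f x + f y. Proof. exact: linearD F x y. Qed.
Lemma linB x y : f (x - y) = f x - f y. Proof. exact: linearB F x y. Qed.
Lemma linZ k x : f (k *: x) = k *: f x. Proof. exact: linearZ_LR F k x. Qed.
Lemma lin_sum (J : Type) (r : seq J) (P : pred J) (u : J -> U) :
  f (\sum_(j <- r | P j) u j) = \sum_(j <- r | P j) f (u j).
Proof. exact: linear_sum F _ _ _ _. Qed.

End UnbundledLinear.

HB.instance Definition _ (C : fieldType) (A : comAlgType C) (G : groupScheme A)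
    (g : lieAlgebra G) (x : g) :=
  GRing.isLinear.Build C A C *%R (tangent x) (tangentP x).1.

Lemma der_fun_linear (C : fieldType) (A : comAlgType C) (d : der A) : linear d.
Proof. by move=> k a b; rewrite (derP d).1; congr (_ + _); apply: mulr_algl. Qed.

HB.instance Definition _ (C : fieldType) (A : comAlgType C) (d : der A) :=
  GRing.isLinear.Build C A A *:%R (der_fun d) (@der_fun_linear C A d).

Section InvariantFields.
Variables (C : fieldType) (A : comAlgType C) (G : groupScheme A) (g : lieAlgebra G).
Implicit Types (f h : A) (x y z : g).

Lemma derM (d : der A) f h : d (f * h) = f * d h + h * d f.
Proof. by rewrite (derP d).2. Qed.

Lemma der_sum (d : der A) (J : Type) (r : seq J) (u : J -> A) :
  d (\sum_(j <- r) u j) = \sum_(j <- r) d (u j).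
Proof. exact: (lin_sum (@der_fun_linear C A d)). Qed.

Lemma derZ (d : der A) k f : d (k *: f) = k *: d f.
Proof. exact: (linZ (@der_fun_linear C A d)). Qed.

Lemma derA1 (d : der A) : d 1 = 0.
Proof.
have := derM d 1 1; rewrite mulr1 !mul1r -[in X in X = _](addr0 (d 1)).
by move=> /addrI <-.
Qed.

Lemma comul_linear_sum (M : lmodType C) (b : A -> A -> M) : bilinear_map b ->
  linear (fun f => \sum_(p <- comul G f) b p.1 p.2).
Proof.
move=> bP k f h; rewrite (comul_lin G k f h bP) big_cat big_map scaler_sumr /=.
congr (_ + _); apply: eq_bigr => p _.
exact: linZ (bP.2 p.2) _ _.
Qed.

Lemma comul_comb (M : lmodType C) (b : A -> A -> M) (J : Type) (r : seq J)
    (k : J -> C) (u : J -> A) : bilinear_map b ->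
  \sum_(p <- comul G (\sum_(j <- r) k j *: u j)) b p.1 p.2 =
  \sum_(j <- r) k j *: \sum_(p <- comul G (u j)) b p.1 p.2.
Proof.
move=> bP; rewrite (lin_sum (comul_linear_sum bP)); apply: eq_bigr => j _.
exact: linZ (comul_linear_sum bP) _ _.
Qed.

(** Left invariance: on the function f (g h) the field [iL x] acts through the variable h. This is
    coassociativity with [x] paired to the last factor. *)
Lemma comul_left_field (M : lmodType C) (b : A -> A -> M) x f : bilinear_map b ->
  \sum_(p <- comul G (iL x f)) b p.1 p.2 = \sum_(p <- comul G f) b p.1 (iL x p.2).
Proof.
move=> bP; rewrite /= /left_field (comul_comb _ (fun p => tangent x p.2) fst) //.
pose t u v w := tangent x w *: b u v.
have tP : trilinear_map t.
  split=> [u v k w w'|u w k v v'|v w k u u']; rewrite /t.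
  - by rewrite linearP scalerDl scalerA.
  - by rewrite (bP.1 u) scalerDr !scalerA mulrC.
  - by rewrite (bP.2 v) scalerDr !scalerA mulrC.
transitivity (\sum_(p <- comul G f) \sum_(q <- comul G p.1) t q.1 q.2 p.2).
  by apply: eq_bigr => p _; exact: scaler_sumr.
rewrite (comul_coassoc G f tP); apply: eq_bigr => p _; rewrite /t.
rewrite (lin_sum (bP.1 p.1)); apply: eq_bigr => q _.
by rewrite (linZ (bP.1 p.1)).
Qed.

(** Right invariance: on f (g h) the field [iR x] acts through g, by coassociativity with [x] paired
    to the first factor. *)
Lemma comul_right_field (M : lmodType C) (b : A -> A -> M) x f : bilinear_map b ->
  \sum_(p <- comul G (iR x f)) b p.1 p.2 = \sum_(p <- comul G f) b (iR x p.1) p.2.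
Proof.
move=> bP.
have -> : iR x f = \sum_(p <- comul G f) (- tangent x p.1) *: p.2.
  by rewrite /= /right_field -sumrN; apply: eq_bigr => p _; rewrite scaleNr.
rewrite (comul_comb _ (fun p => - tangent x p.1) snd) //.
pose t u v w := - tangent x u *: b v w.
have tP : trilinear_map t.
  split=> [u v k w w'|u w k v v'|v w k u u']; rewrite /t.
  - by rewrite (bP.1 v) scalerDr !scalerA mulrC.
  - by rewrite (bP.2 w) scalerDr !scalerA mulrC.
  - by rewrite linearP opprD scalerDl scalerA mulrN.
transitivity (\sum_(p <- comul G f) \sum_(q <- comul G p.2) t p.1 q.1 q.2).
  by apply: eq_bigr => p _; exact: scaler_sumr.
rewrite -(comul_coassoc G f tP); apply: eq_bigr => p _; rewrite /t.
rewrite (linN (bP.2 p.2)) (lin_sum (bP.2 p.2)) -sumrN; apply: eq_bigr => q _.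
by rewrite (linZ (bP.2 p.2)) scaleNr.
Qed.

Lemma counit_left_field x f : (counit G (iL x f) : C) = tangent x f.
Proof.
rewrite /= /left_field linear_sum -[in RHS](counitl G f) linear_sum.
by apply: eq_bigr => p _; rewrite !linearZ /= mulrC.
Qed.

Lemma counit_right_field x f : (counit G (iR x f) : C) = - tangent x f.
Proof.
rewrite /= /right_field linearN /=; congr (- _).
rewrite linear_sum -[in RHS](counitr G f) linear_sum.
by apply: eq_bigr => p _; rewrite !linearZ /= mulrC.
Qed.

(** Up to sign, both sides pair [y] with the first and [x] with the second factor of the
    comultiplication of [f]. *)
Lemma tangent_right_field x y f : tangent x (iR y f) = - tangent y (iL x f).
Proof.
rewrite /= /right_field /left_field linearN; congr (- _).
by rewrite !linear_sum; apply: eq_bigr => p _; rewrite !linearZ /= mulrC.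
Qed.

Lemma left_bilinear x : bilinear_map (fun u v : A => tangent x v *: u).
Proof.
split=> [u k v w|v k u w]; first by rewrite linearP scalerDl scalerA.
by rewrite scalerDr !scalerA mulrC.
Qed.

Lemma right_bilinear x : bilinear_map (fun u v : A => tangent x u *: v).
Proof.
split=> [u k v w|v k u w]; last by rewrite linearP scalerDl scalerA.
by rewrite scalerDr !scalerA mulrC.
Qed.

Lemma left_field_br x y f : iL (br x y) f = iL x (iL y f) - iL y (iL x f).
Proof.
rewrite [iL x _]/= [iL y (iL x f)]/= /left_field.
rewrite !(comul_left_field _ _ (left_bilinear _)) -sumrB /= /left_field.
by apply: eq_bigr => p _; rewrite tangent_br scalerBl.
Qed.

(** The two fields act on different tensor factors of the comultiplication. *)
Lemma left_right_comm x y f : iL y (iR x f) = iR x (iL y f).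
Proof.
rewrite [iL y _]/= [iL y f]/= /left_field.
rewrite (comul_right_field _ _ (left_bilinear _)) linear_sum.
by apply: eq_bigr => p _; rewrite linearZ.
Qed.

(** In [iR x (iR y f)] the two signs cancel and [tangent_right_field] reverses the order of [x] and
    [y]; the single sign in [iR (br x y)] makes up for the reversal. *)
Lemma right_field_br x y f : iR (br x y) f = iR x (iR y f) - iR y (iR x f).
Proof.
have E (u v : g) : iR u (iR v f) = - \sum_(p <- comul G f) tangent u (iR v p.1) *: p.2.
  by rewrite -(comul_right_field _ _ (right_bilinear u)).
rewrite !E opprK addrC -sumrB.
rewrite [iR (br x y) f]/= /right_field -sumrN; apply: eq_bigr => p _.
rewrite !tangent_right_field tangent_br -scalerBl -scaleNr.
by congr (_ *: _); rewrite opprB opprK addrC.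
Qed.

Lemma left_field_linear k x y f : iL (k *: x + y) f = k *: iL x f + iL y f.
Proof.
rewrite /= /left_field scaler_sumr -big_split; apply: eq_bigr => p _ /=.
by rewrite tangent_lin scalerDl scalerA.
Qed.

Lemma right_field_linear k x y f : iR (k *: x + y) f = k *: iR x f + iR y f.
Proof.
rewrite /= /right_field scalerN -opprD scaler_sumr -big_split; congr (- _).
by apply: eq_bigr => p _ /=; rewrite tangent_lin scalerDl scalerA.
Qed.

(** A left invariant field is determined by its value at 1. Through this faithfulness, bilinearity,
    antisymmetry and the Jacobi identity of [br] come from commutators of derivations. *)
Lemma left_field_inj x y : iL x =1 iL y -> x = y.
Proof.
by move=> E; apply: tangent_inj => f; rewrite -!counit_left_field E.
Qed.

Lemma br_linl z : linear (fun x => br x z).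
Proof.
move=> k x y; apply: left_field_inj => f.
rewrite left_field_linear !left_field_br !left_field_linear linearP.
by rewrite scalerBr opprD addrACA.
Qed.

Lemma br_anti x y : br x y = - br y x.
Proof.
apply: left_field_inj => f; rewrite -[- _]addr0 -scaleN1r left_field_linear.
rewrite !left_field_br scaleN1r opprB -[in LHS](addr0 (_ - _)); congr (_ + _).
have := left_field_linear 1 (0 : g) 0 f.
by rewrite !scale1r addr0 -[in X in X = _](addr0 (iL (0 : g) f)) => /addrI.
Qed.

Lemma br_linr z : linear (br z).
Proof.
by move=> k x y; rewrite br_anti br_linl opprD -scalerN -!br_anti.
Qed.

Lemma br_jacobi x y z : br (br x y) z = br x (br y z) - br y (br x z).
Proof.
apply: left_field_inj => f; rewrite addrC -scaleN1r.
have dB (d : der A) a b : d (a - b) = d a - d b by apply: linearB.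
rewrite left_field_linear !left_field_br scaleN1r !dB.
ring.
Qed.

End InvariantFields.

(** * Traces and the Killing form *)

Section Trace.
Variables (C : fieldType) (V : vectType C).
Local Notation e := (vbasis {:V}).

Lemma vbasis_sum (x : V) : x = \sum_(i < \dim {:V}) coord e i x *: e`_i.
Proof. exact/coord_vbasis/memvf. Qed.

Lemma coord_vbasis_nth (i j : 'I_(\dim {:V})) : coord e j e`_i = (j == i)%:R.
Proof. by rewrite coord_free ?(basis_free (vbasisP _)) // eq_sym. Qed.

Definition endo_trace (phi : V -> V) : C :=
  \sum_(i < \dim {:V}) coord e i (phi e`_i).

Lemma eq_endo_trace (phi psi : V -> V) : phi =1 psi -> endo_trace phi = endo_trace psi.
Proof. by move=> E; apply: eq_bigr => i _; rewrite E. Qed.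

Lemma endo_trace_comm (phi psi : V -> V) : linear phi -> linear psi ->
  endo_trace (phi \o psi) = endo_trace (psi \o phi).
Proof.
move=> lphi lpsi.
have E (f h : V -> V) : linear f -> endo_trace (f \o h) =
    \sum_(i < \dim {:V}) \sum_(k < \dim {:V})
      coord e k (h e`_i) * coord e i (f e`_k).
  move=> lf; apply: eq_bigr => i _; rewrite /= {1}(vbasis_sum (h e`_i)).
  rewrite (lin_sum lf) linear_sum; apply: eq_bigr => k _.
  by rewrite (linZ lf) linearZ.
rewrite (E _ _ lphi) (E _ _ lpsi) exchange_big; apply: eq_bigr => i _.
by apply: eq_bigr => k _; rewrite mulrC.
Qed.

Lemma endo_traceB (phi psi : V -> V) :
  endo_trace (fun x => phi x - psi x) = endo_trace phi - endo_trace psi.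
Proof. by rewrite -sumrB; apply: eq_bigr => i _; rewrite linearB. Qed.

End Trace.

Section Killing.
Variables (C : fieldType) (A : comAlgType C) (G : groupScheme A) (g : lieAlgebra G).
Implicit Types x y z : g.

Lemma killingE x y : killing x y = endo_trace (br x \o br y).
Proof. by []. Qed.

Lemma killing_sym x y : killing x y = killing y x.
Proof. exact: endo_trace_comm (br_linr x) (br_linr y). Qed.

Lemma killing_linl z : linear_for *%R (fun x => killing x z).
Proof.
move=> k x y; rewrite /killing mulr_sumr -big_split; apply: eq_bigr => i _ /=.
by rewrite br_linl linearP.
Qed.

(** With [br (br x y)] equal to the commutator of [X] and [Y], both sides become tr (X Y Z) - tr (X
    Z Y) by cyclicity of the trace. *)
Lemma killing_inv x y z : killing (br x y) z = killing x (br y z).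
Proof.
have lc u v : linear (br u \o br v : g -> g).
  by move=> k w w' /=; rewrite !br_linr.
rewrite !killingE; set X := br x; set Y := br y; set Z := br z.
transitivity (endo_trace (X \o (Y \o Z)) - endo_trace (Y \o (X \o Z))).
  by rewrite -endo_traceB; apply: eq_endo_trace => w /=; rewrite br_jacobi.
rewrite -(endo_trace_comm (lc x z) (br_linr y)) -endo_traceB.
by apply: eq_endo_trace => w; rewrite /X /= br_jacobi (linB (br_linr x)).
Qed.

Lemma trace_ad_br x y : endo_trace (br (br x y)) = 0.
Proof.
transitivity (endo_trace (br x \o br y) - endo_trace (br y \o br x)).
  by rewrite -endo_traceB; apply: eq_endo_trace => w /=; rewrite br_jacobi.
by rewrite (endo_trace_comm (br_linr x) (br_linr y)) subrr.
Qed.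

Lemma form_sumr (B : g -> g -> C) (J : Type) (s : seq J) (k : J -> C)
    (u : J -> g) z : invariant_form B ->
  B z (\sum_(j <- s) k j *: u j) = \sum_(j <- s) k j * B z (u j).
Proof.
move=> hB; elim: s => [|j s IH]; last by rewrite !big_cons (form_linr hB) IH.
rewrite !big_nil; have := form_linr hB (-1) z 0 0.
by rewrite scaler0 addr0 mulN1r addNr.
Qed.

Lemma dual_form_invariant (B : g -> g -> C) :
  invariant_form B -> invariant_form (dual_form B).
Proof.
case=> Bl Br Bs Bi; have sym u v : dual_form B u v = dual_form B v u.
  by rewrite /dual_form killing_sym Bs.
have linl k u v w : dual_form B (k *: u + v) w = k * dual_form B u w + dual_form B v w.
  by rewrite /dual_form Bl killing_linl; ring.
split=> [//|k u v w|//|u v w]; first by rewrite sym linl ![dual_form B u _]sym.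
by rewrite /dual_form Bi killing_inv.
Qed.

End Killing.

(** * Coordinates at 1 and expansions in the left invariant frame *)

Section Frame.
Variables (C : fieldType) (A : comAlgType C) (G : groupScheme A) (g : lieAlgebra G).
Local Notation n := (\dim {:g}).
Local Notation e := (vbasis {:g}).
Implicit Types (f h : A) (x y z : g).

(* Functions vanishing at 1 whose differentials at 1 are the dual basis of [e]. *)
Definition dual_coordinates (fr : 'I_n -> A) : Prop :=
  forall i, (counit G (fr i) : C) = 0 /\ forall x, tangent x (fr i) = coord e i x.

Lemma tangent1 x : tangent x (1 : A) = 0.
Proof.
have := (tangentP x).2 1 1; rewrite mulr1 (rmorph1 (counit G)) mul1r mulr1.
by rewrite -[in X in X = _](addr0 (tangent x 1)) => /addrI <-.
Qed.

Lemma tangent_suml (J : Type) (s : seq J) (k : J -> C) (u : J -> g) f :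
  tangent (\sum_(j <- s) k j *: u j) f = \sum_(j <- s) k j * tangent (u j) f.
Proof.
elim: s => [|j s IH]; last by rewrite !big_cons tangent_lin IH.
rewrite !big_nil; have := tangent_lin 1 (0 : g) 0 f.
by rewrite scale1r mul1r addr0 -[in X in X = _](addr0 (tangent 0 f)) => /addrI.
Qed.

(** If differentials at 1 missed a dual basis vector, a functional killing all of them would be
    evaluation on a tangent vector [x]. This [x] kills every function, so it is 0, yet its j-th
    coordinate is 1. *)
Lemma dual_coordinates_exist : exists fr, dual_coordinates fr.
Proof.
have frj j : exists f, (counit G f : C) = 0 /\ forall x, tangent x f = coord e j x.
  pose ev f : 'rV[C]_n := \row_i tangent e`_i f.
  have evL : linear ev by move=> k f h; apply/rowP => i; rewrite !mxE linearP.
  have [[f fj]|nf] := pselect (exists f, ev f = delta_mx 0 j).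
    exists (f - (counit G f : C)%:A); split.
      rewrite (rmorphB (counit G)) /= -mulr_algl mulr1.
      by rewrite linearZ /= (rmorph1 (counit G)) -[_ *: _]/(_ * _) mulr1 subrr.
    move=> x; rewrite linearB linearZ /= tangent1 mulr0 subr0.
    rewrite [in LHS](vbasis_sum x) tangent_suml (bigD1 j) //= big1 => [|i ij].
      by have /rowP/(_ j) := fj; rewrite !mxE !eqxx /= => ->; rewrite mulr1 addr0.
    by have /rowP/(_ i) := fj; rewrite !mxE (negPf ij) andbF => ->; rewrite mulr0.
  have [|lam [lamev lam1]] := @separating_functional _ _ (fun v => exists f, ev f = v)
      (delta_mx 0 j) _ nf.
    split; first by exists 0; rewrite (lin0 evL).
    by move=> k _ _ [f <-] [h <-]; exists (k *: f + h); rewrite evL.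
  pose x := \sum_i lam (delta_mx 0 i) *: e`_i.
  have x0 : x = 0.
    apply: tangent_inj => f; have := @tangent_suml void [::] (fun=> 0) (fun=> 0) f.
    rewrite !big_nil => ->; rewrite tangent_suml.
    transitivity (lam (ev f)); last by apply: lamev; exists f.
    rewrite [ev f]row_sum_delta linear_sum; apply: eq_bigr => i _.
    by rewrite linearZ mxE mulrC.
  have := linear0 (coord e j); rewrite -x0 linear_sum (bigD1 j) //= big1 => [|i ij].
    rewrite linearZ /= coord_vbasis_nth eqxx lam1 mulr1 addr0 => /eqP.
    by rewrite oner_eq0.
  by rewrite linearZ /= coord_vbasis_nth eq_sym (negPf ij) mulr0.
have [fr frP] := choice frj; by exists fr.
Qed.

End Frame.

Section FrameExpansion.
Variables (C : fieldType) (A : comAlgType C) (G : groupScheme A) (g : lieAlgebra G).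
Local Notation n := (\dim {:g}).
Local Notation e := (vbasis {:g}).
Variable fr : 'I_n -> A.
Hypothesis frP : dual_coordinates fr.
Implicit Types (f h : A) (x y z : g).

Lemma point_derivation_expand (d : A -> C) f : point_derivation G d ->
  d f = \sum_(i < n) d (fr i) * tangent e`_i f.
Proof.
move=> dP; have [x xd] := tangent_surj g dP; rewrite -xd {1}(vbasis_sum x) tangent_suml.
by apply: eq_bigr => i _; rewrite -xd (frP i).2.
Qed.

Section Derivation.
Variables (M : lmodType C) (act : A -> M -> M) (d : A -> M).
Hypothesis act_linl : forall u, linear (act^~ u).
Hypothesis act_linr : forall a, linear (act a).
Hypothesis act1 : forall c, act 1 (d c) = d c.
Hypothesis actA : forall a b c, act a (act b (d c)) = act (a * b) (d c).
Hypothesis d_lin : linear d.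
Hypothesis dM : forall a b, d (a * b) = act a (d b) + act b (d a).

(* For the universal derivation [d], this is the left invariant form with value
   [d f] at 1. *)
Definition left_coef f : M := \sum_(p <- comul G f) act (antipode G p.1) (d p.2).

Lemma left_coef_bilinear : bilinear_map (fun u v => act (antipode G u) (d v)).
Proof.
split=> [u k v w|v k u w]; first by rewrite d_lin act_linr.
by rewrite linearP act_linl.
Qed.

Lemma left_coef_linear : linear left_coef.
Proof. exact: comul_linear_sum left_coef_bilinear. Qed.

(** An invariant form depends only on its value at 1, where the Leibniz rule becomes that of a point
    derivation. In [half], the antipode contracts the factor that is not differentiated. *)
Lemma left_coefM f h : left_coef (f * h) =
  (counit G f : C) *: left_coef h + (counit G h : C) *: left_coef f.
Proof.
have half a b : \sum_(p <- comul G a) \sum_(q <- comul G b)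
    act (antipode G p.1 * p.2 * antipode G q.1) (d q.2) =
    (counit G a : C) *: left_coef b.
  rewrite exchange_big scaler_sumr; apply: eq_bigr => q _ /=.
  rewrite -(lin_sum (act_linl (d q.2))) -mulr_suml antipodel mulr_algl.
  exact: linZ (act_linl (d q.2)) _ _.
rewrite /left_coef (comul_mul G f h left_coef_bilinear) big_allpairs_dep /=.
rewrite -!half [X in _ + X]exchange_big -big_split; apply: eq_bigr => p _ /=.
rewrite -big_split; apply: eq_bigr => q _ /=.
rewrite dM (linD (act_linr _)) !actA rmorphM; congr (act _ _ + act _ _).
  by rewrite mulrAC.
by rewrite -mulrA mulrC -mulrA.
Qed.

(** For each functional [lam] on [M], [lam] composed with [left_coef] is a point derivation, so it
    expands in the basis; functionals separate the vectors of [M]. *)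
Lemma left_coef_expand f : left_coef f = \sum_(i < n) tangent e`_i f *: left_coef (fr i).
Proof.
apply/eqP; rewrite -subr_eq0; apply/eqP; set v := _ - _; apply: contrapT => v0.
have [|lam [_ lamv]] := @separating_functional C M (fun u => u = 0) v _ v0.
  by split=> // k u w -> ->; rewrite scaler0 addr0.
have pd : point_derivation G (fun a => lam (left_coef a)).
  split=> [k a b|a b]; first by rewrite left_coef_linear linearP.
  by rewrite left_coefM linearD !linearZ /= [lam _ * _]mulrC.
have /= E := point_derivation_expand f pd.
move: lamv; rewrite /v linearB E linear_sum.
under [X in _ - X]eq_bigr do rewrite linearZ /= mulrC.
by rewrite subrr => /esym/eqP; rewrite oner_eq0.
Qed.

(** Insert the antipode identity to write [d c] as the sum of the [act p.1 (left_coef p.2)], then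
    expand each invariant form in the frame. The module laws for [act] are assumed on values of [d]
    only, as the product a_(-1) v of a vertex algebra is not associative on all [v]. *)
Lemma frame_expansion c : d c = \sum_(i < n) act (iL e`_i c) (left_coef (fr i)).
Proof.
pose t u v w := act (u * antipode G v) (d w).
have tP : trilinear_map t.
  split=> [u v k w w'|u w k v v'|v w k u u']; rewrite /t.
  - by rewrite d_lin act_linr.
  - by rewrite linearP mulrDr -scalerAr act_linl.
  - by rewrite mulrDl -scalerAl act_linl.
transitivity (\sum_(p <- comul G c) act p.1 (left_coef p.2)).
  transitivity (\sum_(p <- comul G c) \sum_(q <- comul G p.1) t q.1 q.2 p.2).
    rewrite -{1}(counitl G c) (lin_sum d_lin); apply: eq_bigr => p _.
    rewrite /t -(lin_sum (act_linl (d p.2))) antipoder (linZ d_lin).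
    by rewrite (linZ (act_linl (d p.2))) act1.
  rewrite (comul_coassoc G c tP); apply: eq_bigr => p _.
  by rewrite /left_coef (lin_sum (act_linr p.1)); apply: eq_bigr => q _; rewrite actA.
under eq_bigr => p _ do rewrite left_coef_expand (lin_sum (act_linr p.1)).
rewrite exchange_big; apply: eq_bigr => i _ /=.
rewrite /left_field (lin_sum (act_linl _)); apply: eq_bigr => p _.
by rewrite (linZ (act_linr _)) (linZ (act_linl _)).
Qed.

End Derivation.

Lemma left_field_contraction x f :
  \sum_(p <- comul G f) antipode G p.1 * iL x p.2 = (tangent x f)%:A.
Proof.
pose t u v w : A := tangent x w *: (antipode G u * v).
have tP : trilinear_map t.
  split=> [u v k w w'|u w k v v'|v w k u u']; rewrite /t.
  - by rewrite linearP scalerDl scalerA.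
  - by rewrite mulrDr -scalerAr scalerDr !scalerA mulrC.
  - by rewrite linearP mulrDl -scalerAl scalerDr !scalerA mulrC.
transitivity (\sum_(p <- comul G f) \sum_(q <- comul G p.2) t p.1 q.1 q.2).
  apply: eq_bigr => p _; rewrite /= /left_field mulr_sumr; apply: eq_bigr => q _.
  by rewrite -scalerAr.
rewrite -(comul_coassoc G f tP) -{2}(counitl G f) linear_sum scaler_suml.
apply: eq_bigr => p _; rewrite /t -scaler_sumr antipodel scalerA.
by rewrite mulrC; congr (_ *: _); rewrite linearZ.
Qed.

(** Contracting the field with the invariant form of [fr j] recovers its j-th coefficient. *)
Lemma frame_uniq (h k : 'I_n -> A) :
  (forall f, \sum_(i < n) h i * iL e`_i f = \sum_(i < n) k i * iL e`_i f) -> h =1 k.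
Proof.
move=> hk j; have E (u : 'I_n -> A) :
    \sum_(p <- comul G (fr j)) antipode G p.1 * (\sum_(i < n) u i * iL e`_i p.2) = u j.
  under eq_bigr => p _ do rewrite mulr_sumr.
  rewrite exchange_big (bigD1 j) //= [X in _ + X]big1 => [|i ij].
    under eq_bigr => p _ do rewrite mulrCA.
    rewrite -mulr_sumr (left_field_contraction e`_j) (frP j).2 coord_vbasis_nth.
    by rewrite eqxx scale1r mulr1 addr0.
  under eq_bigr => p _ do rewrite mulrCA.
  rewrite -mulr_sumr (left_field_contraction e`_i) (frP j).2 coord_vbasis_nth.
  by rewrite eq_sym (negPf ij) scale0r mulr0.
by rewrite -(E h) -(E k); apply: eq_bigr => p _; rewrite hk.
Qed.

Lemma left_field_suml (J : Type) (s : seq J) (k : J -> C) (u : J -> g) f :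
  iL (\sum_(j <- s) k j *: u j) f = \sum_(j <- s) k j *: iL (u j) f.
Proof.
have L : linear (fun x => iL x f) by move=> c x y; apply: left_field_linear.
by rewrite (lin_sum L); apply: eq_bigr => j _; rewrite (linZ L).
Qed.

Lemma left_field_basis x f : iL x f = \sum_(i < n) coord e i x *: iL e`_i f.
Proof. by rewrite {1}(vbasis_sum x) left_field_suml. Qed.

(* The coefficients of g |-> - Ad (g^-1) x. *)
Definition adj x (i : 'I_n) : A :=
  \sum_(p <- comul G (fr i)) antipode G p.1 * iR x p.2.

Lemma right_field_frame x f : iR x f = \sum_(i < n) adj x i * iL e`_i f.
Proof.
transitivity (\sum_(i < n) iL e`_i f * adj x i); last first.
  by apply: eq_bigr => i _; rewrite mulrC.
apply: (frame_expansion (M := A) (act := fun a u : A => a * u) (d := iR x)).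
- by move=> u k a b; rewrite mulrDl -scalerAl.
- by move=> a k u v; rewrite mulrDr -scalerAr.
- by move=> c; rewrite mul1r.
- by move=> a b c; rewrite mulrA.
- exact: der_fun_linear.
- by move=> a b; rewrite derM.
Qed.

Lemma adj_linear i : linear (adj^~ i).
Proof.
move=> k x y; rewrite /adj scaler_sumr -big_split; apply: eq_bigr => p _.
by rewrite (right_field_linear k x y) mulrDr -scalerAr.
Qed.

Lemma counit_adj x i : (counit G (adj x i) : C) = - coord e i x.
Proof.
rewrite -(frP i).2 -counit_right_field right_field_frame.
rewrite [RHS](rmorph_sum (counit G)).
transitivity (\sum_(k < n) (counit G (adj x k) : C) * (i == k)%:R).
  rewrite [RHS](bigD1 i) //= eqxx mulr1 [X in _ + X]big1 ?addr0 // => k ki.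
  by rewrite eq_sym (negPf ki) mulr0.
apply: eq_bigr => k _; rewrite (rmorphM (counit G)) -coord_vbasis_nth -(frP i).2.
by congr (_ * _); apply/esym/counit_left_field.
Qed.

(** Expand the vanishing commutator of [iL y] and [iR x] in the frame and compare coefficients. *)
Lemma left_adj y x i :
  iL y (adj x i) = - \sum_(k < n) coord e i (br y e`_k) *: adj x k.
Proof.
move: i; apply: frame_uniq => f.
transitivity (\sum_(i < n) adj x i * (iL e`_i (iL y f) - iL y (iL e`_i f))).
  under [RHS]eq_bigr => i _ do rewrite mulrBr.
  rewrite [RHS]sumrB -right_field_frame -left_right_comm right_field_frame der_sum.
  by rewrite -sumrB; apply: eq_bigr => i _; rewrite derM [X in X - _]addrC addrK mulrC.
transitivity (- \sum_(k < n) \sum_(i < n) adj x k * (coord e i (br y e`_k) *: iL e`_i f)).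
  rewrite -sumrN; apply: eq_bigr => k _; rewrite -mulr_sumr -mulrN; congr (_ * _).
  by rewrite -left_field_basis left_field_br opprB.
rewrite exchange_big -sumrN; apply: eq_bigr => i _ /=.
rewrite mulNr mulr_suml; congr (- _); apply: eq_bigr => k _.
by rewrite -scalerAr -scalerAl.
Qed.

(** Since [iR x] commutes with the frame, its commutator with [iR y] is found by differentiating the
    coefficients of [iR y]. *)
Lemma right_adj x y i : iR x (adj y i) = adj (br x y) i.
Proof.
move: i; apply: frame_uniq => f.
rewrite -right_field_frame right_field_br [iR y f]right_field_frame der_sum.
rewrite [iR y (iR x f)]right_field_frame -sumrB; apply: eq_bigr => i _.
by rewrite derM -left_right_comm [X in X - _]addrC addrK mulrC.
Qed.

End FrameExpansion.

(** * Functions killed by the left invariant vector fields *)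

(* The induction on [s] eliminates a first component that depends on the others
   modulo [I]; otherwise a functional isolates the second component. *)
Lemma tensor_slices (C : fieldType) (A M : lmodType C) (I W : A -> Prop)
    (J : M -> Prop) (b : A -> A -> M) (s : seq (A * A)) :
  subspace I -> subspace W -> subspace J ->
  (forall u, linear (b u)) -> (forall v, linear (b^~ v)) ->
  (forall u v, I u -> J (b u v)) -> (forall u v, W v -> J (b u v)) ->
  (forall mu : {scalar A}, (forall x, I x -> mu x = 0) ->
     W (\sum_(q <- s) mu q.1 *: q.2)) ->
  J (\sum_(q <- s) b q.1 q.2).
Proof.
move=> Isub Wsub Jsub br bl bI bW.
elim: {s}(size s) {-2}s (erefl (size s)) => [|N IH] s.
  by move=> /size0nil -> _; rewrite big_nil; case: Jsub.
case: s => // p s [sN] slices.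
pose S x := exists (y : A) (c : nat -> C), I y /\
  x = y + \sum_(0 <= i < size s) c i *: (nth (0, 0) s i).1.
have Ssub : subspace S.
  split.
    exists 0, (fun=> 0); split; first by case: Isub.
    by rewrite big1 ?addr0 // => i _; rewrite scale0r.
  move=> k x x' [y [c [Iy ->]]] [y' [c' [Iy' ->]]].
  exists (k *: y + y'), (fun i => k * c i + c' i); split; first exact: Isub.2.
  rewrite scalerDr addrACA scaler_sumr -big_split; congr (_ + _).
  by apply: eq_bigr => i _; rewrite scalerDl scalerA.
have [[y [c [Iy pE]]]|nS] := pselect (S p.1).
  (* Substituting for [p.1] moves [c i *: p.2] into the i-th second component; a functional
     vanishing on [I] kills [y], so the slices do not change. *)
  pose s' := mkseq (fun i =>
    ((nth (0, 0) s i).1, (nth (0, 0) s i).2 + c i *: p.2)) (size s).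
  have sumE (F : A -> A -> M) : (forall u, linear (F u)) -> (forall v, linear (F^~ v)) ->
      \sum_(q <- p :: s) F q.1 q.2 = F y p.2 + \sum_(q <- s') F q.1 q.2.
    move=> Fr Fl; rewrite big_cons {1}pE (linD (Fl p.2)) (lin_sum (Fl p.2)) -addrA.
    congr (_ + _); rewrite big_map (big_nth (0, 0)) /index_iota subn0 -big_split.
    apply: eq_bigr => i _ /=; rewrite (linD (Fr _)) (linZ (Fr _)) (linZ (Fl p.2)).
    by rewrite addrC.
  rewrite (sumE b) //; apply: subspaceD => //; first exact: bI.
  apply: IH; first by rewrite size_mkseq sN.
  move=> mu muI.
  have := slices mu muI.
  rewrite big_cons {1}pE linearD muI // add0r linear_sum.
  rewrite [in X in W X -> _](big_nth (0, 0)) scaler_suml -big_split.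
  rewrite big_map /index_iota subn0; congr (W _); apply: eq_bigr => i _ /=.
  by rewrite linearZ /= scalerDr scalerA mulrC addrC.
have [mu [muS mup]] := separating_functional Ssub nS.
have SI x : I x -> S x.
  move=> Ix; exists x, (fun=> 0); split=> //.
  by rewrite big1 ?addr0 // => i _; rewrite scale0r.
have Ss q : q \in s -> S q.1.
  move=> qs; exists 0, (fun i => (i == index q s)%:R); split; first by case: Isub.
  rewrite add0r big_mkord (bigD1 (Ordinal (_ : (index q s < size s)%N))) ?index_mem //=.
  move=> lt; rewrite eqxx scale1r nth_index // big1 ?addr0 // => i ni.
  suff /negPf -> : val i != index q s by rewrite scale0r.
  by apply: contraNneq ni => E; apply/eqP/val_inj.
have Wp : W p.2.
  have := slices mu (fun x Ix => muS x (SI x Ix)).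
  rewrite big_cons mup scale1r big_seq big1 ?addr0 // => q /Ss /muS ->.
  by rewrite scale0r.
rewrite big_cons; apply: subspaceD => //; first exact: bW.
apply: IH => // nu nuI; have := slices nu nuI; rewrite big_cons.
move=> Ws; rewrite -[\sum_(q <- s) _](addKr (nu p.1 *: p.2)) addrC.
by apply: subspaceB => //; apply: subspaceZ.
Qed.

Section LeftInvariantFunctions.
Variables (C : fieldType) (A : comAlgType C) (G : groupScheme A) (g : lieAlgebra G).
Hypothesis charC : forall n, n.+1%:R != 0 :> C.
Local Notation n := (\dim {:g}).
Local Notation e := (vbasis {:g}).
Implicit Types (f h : A) (x y z : g).

Lemma counitM f h : (counit G (f * h) : C) = (counit G f : C) * (counit G h : C).
Proof. exact: (rmorphM (counit G)). Qed.

Lemma counit1 : (counit G 1 : C) = 1.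
Proof. exact: (rmorph1 (counit G)). Qed.

Lemma counitA (k : C) : (counit G k%:A : C) = k.
Proof. by rewrite linearZ /= (rmorph1 (counit G)) -[_ *: _]/(_ * _) mulr1. Qed.

Definition aug_ideal f : Prop := (counit G f : C) = 0.

Lemma aug_ideal_ideal : is_ideal aug_ideal.
Proof.
split=> [|f h f0 h0|f h h0]; first exact: (rmorph0 (counit G)).
  by rewrite /aug_ideal (rmorphD (counit G)) /= f0 h0 addr0.
by rewrite /aug_ideal counitM h0 mulr0.
Qed.

Lemma aug_sub f : aug_ideal (f - (counit G f : C)%:A).
Proof. by rewrite /aug_ideal linearB /= counitA subrr. Qed.

Lemma aug_pow_scale k f j : ideal_pow aug_ideal j f -> ideal_pow aug_ideal j (k *: f).
Proof. by rewrite -mulr_algl; have [_ _] := ideal_pow_ideal aug_ideal j; apply. Qed.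

Lemma aug_pow1 f : aug_ideal f -> ideal_pow aug_ideal 1 f.
Proof. by move=> f0; rewrite -[f]mulr1; apply/ideal_powM/ideal_powT. Qed.

(** Here [W] is the sum of the constants and m^2. A functional that vanishes on [W] is a point
    derivation, hence a tangent vector, and so kills [f]. *)
Lemma aug_square f : aug_ideal f -> (forall x : g, tangent x f = 0) ->
  ideal_pow aug_ideal 2 f.
Proof.
move=> f0 xf; pose W h := ideal_pow aug_ideal 2 (h - (counit G h : C)%:A).
have sq h : aug_ideal h -> W h -> ideal_pow aug_ideal 2 h.
  by rewrite /W => ->; rewrite scale0r subr0.
apply: sq => //; apply: contrapT => nWf.
have [|lam [lamW lamf]] := @separating_functional C A W f _ nWf.
  split=> [|k h h' Wh Wh'].
    by rewrite /W (rmorph0 (counit G)) scale0r subr0; apply: ideal_pow0.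
  rewrite /W linearP /= scalerDl -scalerA opprD addrACA -scalerBr.
  by apply: ideal_powD => //; apply: aug_pow_scale.
have lam1 : lam 1 = 0.
  by apply: lamW; rewrite /W counit1 scale1r subrr; apply: ideal_pow0.
have pd : point_derivation G lam.
  split=> [k h h'|h h']; first by rewrite linearP.
  have : lam ((h - (counit G h : C)%:A) * (h' - (counit G h' : C)%:A)) = 0.
    apply: lamW; rewrite /W counitM !aug_sub mul0r scale0r subr0.
    by apply: ideal_powM; [exact: aug_sub|apply/aug_pow1/aug_sub].
  rewrite mulrBl !mulrBr !mulr_algl [h * _%:A]mulrC mulr_algl.
  by rewrite !linearB !linearZ /= lam1 !mulr0 subr0 => /eqP;
    rewrite subr_eq0 subr_eq addrC => /eqP ->; rewrite [lam h * _]mulrC addrC.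
have [x xlam] := tangent_surj g pd.
by move: lamf; rewrite -xlam xf => /esym/eqP; rewrite oner_eq0.
Qed.

(* The Euler field acts on m^j / m^(j+1) as multiplication by [j], so in
   characteristic 0 a function in m that it kills lies in every power of m. *)
Lemma euler_pow (fr : 'I_n -> A) j f : dual_coordinates fr ->
  ideal_pow aug_ideal j f ->
  ideal_pow aug_ideal j.+1 (\sum_(i < n) fr i * iL e`_i f - f *+ j).
Proof.
move=> frP; pose E h := \sum_(i < n) fr i * iL e`_i h.
rewrite -/(E f).
have ED a b : E (a + b) = E a + E b.
  rewrite -big_split; apply: eq_bigr => i _.
  by rewrite (linD (@der_fun_linear _ _ (iL e`_i))) mulrDr.
have EM a b : E (a * b) = a * E b + b * E a.
  rewrite !mulr_sumr -big_split; apply: eq_bigr => i _.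
  by rewrite derM mulrDr !(mulrCA (fr i)).
have Em a : aug_ideal (E a).
  rewrite /E; apply: (ideal_sum aug_ideal_ideal) => i _.
  by apply: (idealMl _ aug_ideal_ideal); apply: (frP i).1.
have E1 a : aug_ideal a -> ideal_pow aug_ideal 2 (E a - a).
  move=> a0; pose w := a - \sum_(i < n) tangent e`_i a *: fr i.
  have -> : E a - a = \sum_(i < n) fr i * (iL e`_i a - (tangent e`_i a)%:A) - w.
    rewrite /w opprB addrA; congr (_ - _); rewrite -big_split; apply: eq_bigr => i _.
    by rewrite /= mulrBr [fr i * _%:A]mulrC mulr_algl subrK.
  apply: idealB; first exact: ideal_pow_ideal.
    apply: ideal_sum => [|i _]; first exact: ideal_pow_ideal.
    apply: ideal_powM; first exact: (frP i).1.
    by apply: aug_pow1; rewrite -counit_left_field; apply: aug_sub.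
  apply: aug_square => [|x].
    apply: (idealB aug_ideal_ideal) => //.
    apply: (ideal_sum aug_ideal_ideal) => i _; rewrite -mulr_algl.
    by have [_ _] := aug_ideal_ideal; apply; apply: (frP i).1.
  rewrite linearB /= {1}(vbasis_sum x) tangent_suml linear_sum -sumrB big1 // => i _.
  by rewrite linearZ /= (frP i).2 mulrC subrr.
elim=> {j f} [f|j a b ma mb IH|j a b _ IHa _ IHb|j].
- by rewrite mulr0n subr0; apply: aug_pow1.
- rewrite EM mulrSr; have -> : a * E b + b * E a - (a * b *+ j + a * b) =
      a * (E b - b *+ j) + (E a - a) * b.
    by rewrite mulrBr mulrBl opprD addrACA mulrnAr [b * _]mulrC.
  apply: ideal_powD; first exact: ideal_powM.
  exact: (ideal_powMM (E1 _ ma) mb).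
- rewrite ED mulrnDl opprD addrACA; exact: ideal_powD.
- rewrite /E big1 => [|i _]; last by rewrite (lin0 (@der_fun_linear _ _ _)) mulr0.
  by rewrite mul0rn subr0; apply: ideal_pow0.
Qed.

Definition left_const f : Prop := forall x : g, iL x f = 0.

Lemma left_const_pow f j : left_const f -> aug_ideal f -> ideal_pow aug_ideal j f.
Proof.
move=> Kf f0; have [fr frP] := dual_coordinates_exist g.
case: j => [|j]; first exact: ideal_powT.
elim: j => [|j IH]; first exact: aug_pow1.
have := euler_pow frP IH; rewrite big1 ?sub0r => [|i _]; last by rewrite Kf mulr0.
move=> /(aug_pow_scale (- (j.+1%:R)^-1)); rewrite scalerN scaleNr opprK -scaler_nat.
by rewrite scalerA mulVf // scale1r.
Qed.

(** The slices combine the translates f (g h) as functions of h, on which left invariant fields act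
    as on [f]. *)
Lemma left_const_slice f (mu : A -> C) : left_const f -> linear_for *%R mu ->
  left_const (\sum_(p <- comul G f) mu p.1 *: p.2).
Proof.
move=> Kf muL x; rewrite der_sum; under eq_bigr => p _ do rewrite derZ.
have bP : bilinear_map (fun u v => mu u *: v : A).
  split=> [u k v w|v k u w]; last by rewrite muL scalerDl scalerA.
  by rewrite scalerDr !scalerA mulrC.
by rewrite -(comul_left_field x f bP) Kf (lin0 (comul_linear_sum G bP)).
Qed.

Section Neighbourhood.
Variables (I : A -> Prop) (b : A).
Hypothesis Iideal : is_ideal I.
Hypothesis Ik : forall f, left_const f -> aug_ideal f -> I f.
Hypothesis b1 : (counit G b : C) = 1.
Hypothesis bk : forall f, left_const f -> aug_ideal f -> b * f = 0.

Lemma left_const_subspace_ann : subspace (fun v => b * v = (counit G v : C) *: b).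
Proof.
split; first by rewrite mulr0 (rmorph0 (counit G)) scale0r.
by move=> k u v bu bv; rewrite mulrDr -scalerAr bu bv linearP /= scalerDl scalerA.
Qed.

(* In terms of points: [b (g^-1 h)] is 1 on the diagonal, and
   [b (g^-1 h) (f h - f g) = 0]. *)
Lemma slice_annihilates f (mu : {scalar A}) : left_const f -> aug_ideal f ->
  (forall v, I v -> mu v = 0) ->
  (\sum_(q <- comul G b) mu (antipode G q.1) *: q.2) * f = 0.
Proof.
move=> Kf f0 muI.
(* In terms of points, [c u v] applies [mu] in the variable g to u (g) (b v) (g^-1 h), leaving a
   function of h. *)
pose c u v : A := \sum_(r <- comul G (b * v)) mu (u * antipode G r.1) *: r.2.
have cbil u : bilinear_map (fun r1 r2 : A => mu (u * antipode G r1) *: r2).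
  split=> [u1 k v w|v k w w']; first by rewrite scalerDr !scalerA mulrC.
  by rewrite linearP mulrDr -scalerAr linearP scalerDl scalerA.
have cr u : linear (c u).
  move=> k v w; rewrite /c mulrDr -scalerAr.
  exact: (comul_linear_sum G (cbil u)).
have cl v : linear (c^~ v).
  move=> k u w; rewrite /c scaler_sumr -big_split; apply: eq_bigr => r _ /=.
  by rewrite mulrDl -scalerAl linearP scalerDl scalerA.
(* This is the identity f (g g^-1 h) = f (h). *)
have E1 : \sum_(p <- comul G f) c p.1 p.2 = 
    (\sum_(q <- comul G b) mu (antipode G q.1) *: q.2) * f.
  rewrite mulr_suml.
  transitivity (\sum_(p <- comul G f) \sum_(q <- comul G b) \sum_(r <- comul G p.2)
      mu (p.1 * antipode G q.1 * antipode G r.1) *: (q.2 * r.2)).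
    apply: eq_bigr => p _; rewrite /c (comul_mul G b p.2 (cbil p.1)).
    rewrite big_allpairs_dep; apply: eq_bigr => q _; apply: eq_bigr => r _ /=.
    by rewrite rmorphM mulrA.
  rewrite exchange_big; apply: eq_bigr => q _ /=.
  pose t u v w : A := mu (u * antipode G q.1 * antipode G v) *: (q.2 * w).
  have tP : trilinear_map t.
    split=> [u v k w w'|u w k v v'|v w k u u']; rewrite /t.
    - by rewrite mulrDr scalerDr -scalerAr !scalerA mulrC.
    - by rewrite linearP mulrDr -scalerAr linearP scalerDl scalerA.
    - by rewrite !mulrDl -!scalerAl linearP scalerDl scalerA.
  rewrite -[LHS](comul_coassoc G f tP) -[in RHS](counitl G f) mulr_sumr.
  apply: eq_bigr => p _; rewrite /t -scaler_suml -linear_sum.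
  under eq_bigr => r _ do rewrite mulrAC.
  by rewrite -mulr_suml antipoder mulr_algl linearZ /= -!scalerAr -scalerAl scalerA mulrC.
have E2 : \sum_(p <- comul G f) c ((counit G p.2 : C) *: p.1) 1 = 0.
  rewrite -(lin_sum (cl 1)) counitr /c; rewrite big1 // => r _.
  by rewrite muI ?scale0r //; apply: idealMl => //; apply: Ik.
rewrite -E1; transitivity (\sum_(p <- comul G f)
    (c p.1 p.2 - c ((counit G p.2 : C) *: p.1) 1)).
  by rewrite sumrB E2 subr0.
(* The bilinear map vanishes when [b * v] is the multiple of [b] by the value of [v] at 1. Every
   slice of [f] is such a [v], by [bk] applied to the slice minus its value at 1. *)
apply: (@tensor_slices C A A (fun u => u = 0) _ (fun u => u = 0)
  (fun u v => c u v - c ((counit G v : C) *: u) 1) _ _ left_const_subspace_ann).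
- by split=> // k u v -> ->; rewrite scaler0 addr0.
- by split=> // k u v -> ->; rewrite scaler0 addr0.
- move=> u k v w; rewrite cr linearP /= scalerDl (linD (cl 1)) -scalerA (linZ (cl 1)).
  by rewrite scalerBr opprD addrACA.
- move=> v k u w; rewrite cl scalerDr scalerA mulrC -scalerA cl.
  by rewrite scalerBr opprD addrACA.
- by move=> u v ->; rewrite scaler0 (lin0 (cl v)) (lin0 (cl 1)) subrr.
- move=> u v bv; rewrite (linZ (cl 1)) /c bv mulr1 -(linZ (comul_linear_sum G (cbil u))).
  by rewrite subrr.
move=> nu _; set k := \sum_(p <- _) _.
have Kk : left_const k by apply: left_const_slice => // a u v; apply: linearP.
have := @bk (k - (counit G k : C)%:A); rewrite mulrBr mulr_algr => bk0.
apply/eqP; rewrite -subr_eq0; apply/eqP/bk0; last exact: aug_sub.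
move=> x; rewrite (linB (@der_fun_linear _ _ (iL x))) Kk derZ derA1 scaler0.
by rewrite subrr.
Qed.

(** Restricting b (g^-1 h) to the diagonal gives 1, while its slices modulo [I] annihilate [f].
    Geometrically, [f] vanishes near every point of the zero set of [I]. *)
Lemma annihilator_comaximal f : left_const f -> aug_ideal f ->
  exists2 u, u * f = 0 & I (1 - u).
Proof.
move=> Kf f0; case: (Iideal) => I0 ID IM.
have IZ k (x : A) : I x -> I (k *: x) by move=> Ix; rewrite -mulr_algl; apply: IM.
pose J (x : A) := exists2 u, u * f = 0 & I (x - u).
suff [u uf Iu] : J 1 by exists u.
have -> : 1 = \sum_(q <- [seq (antipode G q.1, q.2) | q <- comul G b]) q.1 * q.2.
  by rewrite big_map antipodel b1 scale1r.
apply: (@tensor_slices C A A I (fun w => w * f = 0) J (fun u v => u * v)).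
- by split=> // k x y Ix Iy; apply: ID => //; apply: IZ.
- split=> [|k x y xf yf]; first by rewrite mul0r.
  by rewrite mulrDl -scalerAl xf yf scaler0 addr0.
- split=> [|k x y [u uf Iu] [v vf Iv]]; first by exists 0; rewrite ?mul0r ?subr0.
  exists (k *: u + v); first by rewrite mulrDl -scalerAl uf vf scaler0 addr0.
  by rewrite opprD addrACA -scalerBr; apply: ID => //; apply: IZ.
- by move=> u k v w; rewrite mulrDr -scalerAr.
- by move=> u k v w; rewrite mulrDl -scalerAl.
- by move=> u v Iu; exists 0; rewrite ?mul0r // subr0; apply: idealMl.
- by move=> u v vf; exists (u * v); rewrite ?subrr // -mulrA vf mulr0.
- by move=> mu muI; rewrite big_map; apply: slice_annihilates.
Qed.

End Neighbourhood.

Theorem left_const_constant f : finite_type A -> spec_connected A ->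
  left_const f -> f = (counit G f : C)%:A.
Proof.
move=> /finite_type_noetherian noeth [_ conn] Kf.
pose K h := left_const h /\ aug_ideal h.
have [s [sK Ks]] := noetherian_fg K noeth.
(* Krull's theorem gives h = a h with a (1) = 0 for each generator [h]; [b] is the product of the
   factors 1 - a. *)
have [b b1 bs] : exists2 b, (counit G b : C) = 1 & forall h, h \in s -> b * h = 0.
  elim: s sK {Ks} => [|h s IH] sK; first by exists 1; rewrite ?counit1.
  have [h' h's|b b1 bs] := IH; first by apply: sK; rewrite inE h's orbT.
  have [Kh h0] := sK h (mem_head _ _).
  have [a a0 hE] := krull_intersection noeth aug_ideal_ideal
    (fun j => left_const_pow j Kh h0).
  exists (b * (1 - a)).
    by rewrite counitM b1 mul1r (rmorphB (counit G)) /= counit1 a0 subr0.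
  move=> h'; rewrite inE => /predU1P [->|/bs bh'].
    by rewrite -mulrA mulrBl mul1r -hE subrr mulr0.
  by rewrite mulrAC bh' mul0r.
have bK h : left_const h -> aug_ideal h -> b * h = 0.
  move=> Kh h0; have [c ->] := Ks h (conj Kh h0).
  by rewrite mulr_sumr big1 // => i _; rewrite mulrCA bs ?mulr0 // mem_nth.
have IK h : left_const h -> aug_ideal h -> comb s h by move=> ? ?; apply: Ks.
have [u us Iu] : exists2 u, (forall h, h \in s -> u * h = 0) & comb s (1 - u).
  have : forall h, h \in s -> exists2 u, u * h = 0 & comb s (1 - u).
    move=> h /sK [Kh h0]; exact: (annihilator_comaximal (comb_ideal s) IK b1 bK).
  elim: {1 3}s => [_|h t IH ex].
    by exists 1; rewrite ?subrr //; have [] := comb_ideal s.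
  have [h' h't|u ut Iu] := IH; first by apply: ex; rewrite inE h't orbT.
  have [v vh Iv] := ex h (mem_head _ _); exists (u * v).
    move=> h'; rewrite inE => /predU1P [->|/ut uh']; first by rewrite -mulrA vh mulr0.
    by rewrite mulrAC uh' mul0r.
  have -> : 1 - u * v = (1 - u) + u * (1 - v) by rewrite mulrBr mulr1 addrA subrK.
  by have [_ D M] := comb_ideal s; apply: D => //; apply: M.
have uK h : left_const h -> aug_ideal h -> u * h = 0.
  move=> Kh h0; have [c ->] := Ks h (conj Kh h0).
  by rewrite mulr_sumr big1 // => i _; rewrite mulrCA us ?mulr0 // mem_nth.
(* [eq u] is the singleton of [u]. The zero sets of [K] and of [u] cover the spectrum because [u]
   annihilates [K], and are disjoint because [1 - u] lies in the ideal of [K]. *)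
have cover p : prime_ideal p -> in_zeros K p \/ in_zeros (eq u) p.
  case=> p0 _ _ _ pM; have [pu|npu] := pselect (p u); first by right=> _ <-.
  by left=> h [Kh h0]; have [] := pM u h; rewrite ?uK.
have disjoint p : prime_ideal p -> ~ (in_zeros K p /\ in_zeros (eq u) p).
  case=> p0 pD pM np1 _ [Kp up]; apply: np1; rewrite -[1](subrK u).
  have pI : is_ideal p by split.
  apply: pD; last exact: up.
  by apply: (comb_in_ideal pI _ Iu) => h /sK; apply: Kp.
have augprime : prime_ideal aug_ideal.
  have [p0 pD pM] := aug_ideal_ideal; split=> // [p1|a c].
    by move: p1; rewrite /aug_ideal counit1 => /eqP; rewrite oner_eq0.
  by rewrite /aug_ideal counitM => /eqP; rewrite mulf_eq0 => /orP [] /eqP; [left|right].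
(* The point 1 lies in the zero set of [K], so the zero set of [u] is empty and [u] is a unit. *)
have [allK|allu] := conn K (eq u) cover disjoint; last first.
  by case: (disjoint _ augprime); split; [move=> h []|apply: allu].
have [p pp pu|w uw] := @unit_of_no_prime C A u.
  by apply: (disjoint p pp); split; [apply: allK|move=> _ <-].
have f'0 : u * (f - (counit G f : C)%:A) = 0.
  apply: uK; last exact: aug_sub.
  by move=> x; rewrite (linB (@der_fun_linear _ _ (iL x))) Kf derZ derA1 scaler0 subrr.
apply/eqP; rewrite -subr_eq0; set h := f - _ in f'0 *.
have -> : h = w * (u * h) by rewrite mulrA [w * u]mulrC uw mul1r.
by rewrite f'0 mulr0.
Qed.

End LeftInvariantFunctions.

(** * Chiral differential operators *)

Section VertexAlgebra.
Variables (C : fieldType) (V : gradedVA C).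
Implicit Types (x y z : V) (m n l : int).

Lemma binz_0r m : binz C m 0 = 1.
Proof. by rewrite /binz big_ord0 fact0 divr1. Qed.

Lemma binz_1r m : binz C m 1 = m%:~R.
Proof. by rewrite /binz big_ord1 factS fact0 divr1 subr0. Qed.

Lemma binz_0l j : binz C 0 j.+1 = 0.
Proof. by rewrite /binz big_ord_recl subr0 !mul0r. Qed.

Lemma sum_ord_trunc k N (F : nat -> V) : (k <= N)%N ->
  (forall j, (k <= j)%N -> F j = 0) -> \sum_(j < N) F j = \sum_(j < k) F j.
Proof.
move=> kN F0; rewrite -!(big_mkord xpredT F) (big_cat_nat (leq0n k) kN) /=.
rewrite [X in _ + X]big1_seq ?addr0 // => j.
by rewrite mem_index_iota => /andP [_ /andP [/F0]].
Qed.

(** The identity holds for all large cutoffs, so each side may be cut where its own terms stop. *)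
Lemma borcherds_trunc (p q : nat) m n l x y z :
  let T1 j := binz C m j *: np (m + l - j%:Z) (np (n + j%:Z) x y) z in
  let T2 j := ((-1) ^+ j * binz C n j) *:
    (np (m + n - j%:Z) x (np (l + j%:Z) y z)
     - (-1) ^ n *: np (n + l - j%:Z) y (np (m + j%:Z) x z)) in
  (forall j : nat, (p <= j)%N -> T1 j = 0) ->
  (forall j : nat, (q <= j)%N -> T2 j = 0) ->
  \sum_(j < p) T1 j = \sum_(j < q) T2 j.
Proof.
move=> T1 T2 T1p T2q; have [N0 HN] := va_borcherds m n l x y z.
have /= := HN (maxn N0 (maxn p q)) (leq_maxl _ _).
rewrite -[LHS]/(\sum_(j < maxn N0 (maxn p q)) T1 j).
rewrite -[RHS]/(\sum_(j < maxn N0 (maxn p q)) T2 j).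
by rewrite (sum_ord_trunc _ T1p) ?(sum_ord_trunc _ T2q) // !leq_max leqnn ?orbT.
Qed.

(** The Borcherds identity with its middle index 0, which leaves one term on the right. *)
Lemma np_commutator m l x y z :
  (forall j : nat, (2 <= j)%N -> np j%:Z x y = 0) ->
  np m x (np l y z) - np l y (np m x z) =
  np (m + l) (np 0 x y) z + m%:~R *: np (m + l - 1) (np 1 x y) z.
Proof.
move=> xy; have /= := @borcherds_trunc 2 1 m 0 l x y z.
rewrite !big_ord_recl !big_ord0 /= /bump /= !addn0 !addr0 ?subr0 !binz_0r !binz_1r !add0r.
rewrite ?expr0 ?expr0z mulr1 !scale1r => -> //.
- by move=> j j2; rewrite add0r xy // np0l scaler0.
- by case=> // j _; rewrite binz_0l mulr0 scale0r.
Qed.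

Lemma np0_derivation l x y z :
  np 0 x (np l y z) = np l (np 0 x y) z + np l y (np 0 x z).
Proof.
have /= := @borcherds_trunc 1 1 0 0 l x y z.
rewrite !big_ord_recl !big_ord0 /= !addr0 !binz_0r !add0r ?subr0.
rewrite ?expr0 ?expr0z mulr1 !scale1r.
move=> -> //; first by rewrite subrK.
- by case=> // j _; rewrite binz_0l scale0r.
- by case=> // j _; rewrite binz_0l mulr0 scale0r.
Qed.

(** The Borcherds identity for the indices 0, -1 and [l]; the terms with [y] outermost vanish. *)
Lemma np_assoc_m1 l x y z :
  (forall j : nat, np j%:Z x z = 0) ->
  (forall j : nat, (2 <= j)%N -> np (l + j%:Z) y z = 0) ->
  np l (np (-1) x y) z = np (-1) x (np l y z) + np (-2) x (np (l + 1) y z).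
Proof.
move=> xz yz; have /= := @borcherds_trunc 1 2 0 (-1) l x y z.
rewrite !big_ord_recl !big_ord0 /= /bump /= !addn0 !addr0 !binz_0r !binz_1r !add0r ?subr0.
rewrite !xz !np0r !scaler0 !subr0 !expr0 expr1 mulr1 mulN1r mulrN1z opprK !scale1r.
rewrite -opprD => -> //.
- by case=> // j _; rewrite binz_0l scale0r.
- by move=> j j2; rewrite add0r xz np0r scaler0 subr0 yz // np0r scaler0.
Qed.

Lemma np_wt_large i j (n : nat) x y : wt i x -> wt j y -> (i + j <= n)%N ->
  np n%:Z x y = 0.
Proof.
move=> wx wy ijn; have := wt_np n%:Z wx wy.
by case E: (_ - 1) => [k|//]; lia.
Qed.

(** Write [x] as x_(-1) applied to the vacuum and move y_(n), which commutes with x_(-1), to the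
    vacuum. *)
Lemma np_skew_zero x y (n : nat) :
  (forall j : nat, np j%:Z x y = 0) -> np n%:Z y x = 0.
Proof.
move=> xy; have := @np_commutator (-1) n x y vac (fun j _ => xy j).
rewrite (xy 0%N) (xy 1%N) !np0l scaler0 addr0 np_vacr np_vacr_ge0 np0r sub0r.
by move=> /eqP; rewrite oppr_eq0 => /eqP.
Qed.

Lemma wt_sum i (J : Type) (r : seq J) (u : J -> V) :
  (forall j, wt i (u j)) -> wt i (\sum_(j <- r) u j).
Proof.
move=> wu; elim: r => [|j r IH]; rewrite (big_nil, big_cons).
  exact: wt_zero.
by rewrite -[u j]scale1r; apply: wt_lin.
Qed.

End VertexAlgebra.

(** * The weight 1 component: currents over vector fields, and one-forms *)

Section WeightOne.
Variables (C : fieldType) (A : comAlgType C) (G : groupScheme A) (g : lieAlgebra G).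
Variables (B : g -> g -> C) (D : cdo B).
Local Notation n := (\dim {:g}).
Local Notation e := (vbasis {:g}).
Local Notation J := (jA D).
Local Notation L := (jL D).
Implicit Types (f h a b c : A) (x y z : g) (u v w : D).

Let rel := cdo_rel D.

Definition dfun c : D := transl (J c).

Definition act a v : D := np (-1) (J a) v.

Lemma act_linl v : linear (act^~ v).
Proof. by move=> k a b; rewrite /act (rel_linA rel) (np_linl (-1) v). Qed.

Lemma act_linr a : linear (act a).
Proof. exact: np_linr. Qed.

Lemma dfun_linear : linear dfun.
Proof. by move=> k a b; rewrite /dfun /transl (rel_linA rel) (np_linl (-2) vac). Qed.

Lemma act_jA a b : act a (J b) = J (a * b).
Proof. exact: (rel_AA rel). Qed.

Lemma act1 v : act 1 v = v.
Proof. by rewrite /act (rel_vac rel) np_vacl. Qed.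

Lemma jA_scalar k : J k%:A = k *: vac.
Proof. by rewrite (linZ (rel_linA rel)) (rel_vac rel). Qed.

Lemma wt_dfun c : wt 1 (dfun c).
Proof. exact: (wt_np (-2) (rel_wtA rel c) (wt_vac D)). Qed.

Lemma wt_act a v : wt 1 v -> wt 1 (act a v).
Proof. exact: (wt_np (-1) (rel_wtA rel a)). Qed.

Lemma np_jA_comm m l a b v :
  np m (J a) (np l (J b) v) = np l (J b) (np m (J a) v).
Proof.
apply/eqP; rewrite -subr_eq0 np_commutator => [|j _]; last exact: (rel_AA_ge0 rel).
by rewrite (rel_AA_ge0 rel a b 0) (rel_AA_ge0 rel a b 1) !np0l scaler0 addr0.
Qed.

Lemma np_jA_dfun a c (j : nat) : np j%:Z (J a) (dfun c) = 0.
Proof. by rewrite /dfun /transl np_jA_comm np_vacr_ge0 np0r. Qed.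

Lemma np_jA_act a b c (j : nat) : np j%:Z (J a) (act b (dfun c)) = 0.
Proof. by rewrite /act np_jA_comm np_jA_dfun np0r. Qed.

(** The defect of associativity, a_(-2) b_(0) v, vanishes here. *)
Lemma act_act a b v :
  (forall j : nat, np j%:Z (J a) v = 0) -> (forall j : nat, np j%:Z (J b) v = 0) ->
  act a (act b v) = act (a * b) v.
Proof.
move=> av bv; rewrite [RHS]/act -act_jA np_assoc_m1 //.
  by rewrite -[LHS]addr0; congr (_ + _); rewrite (bv 0%N) np0r.
by case=> [//|j] _; rewrite intS addKr.
Qed.

Lemma act_act_dfun a b c : act a (act b (dfun c)) = act (a * b) (dfun c).
Proof. by apply: act_act => j; apply: np_jA_dfun. Qed.

Lemma dfunM a b : dfun (a * b) = act a (dfun b) + act b (dfun a).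
Proof.
rewrite {1}/dfun /transl -act_jA np_assoc_m1 //; last first.
- case=> [|[|j]] // _; have -> : -2 + j.+2%:Z = j%:Z by lia.
  exact: np_vacr_ge0.
- by move=> j; apply: np_vacr_ge0.
congr (_ + _).
have -> : -2 + 1 = -1 :> int by [].
rewrite np_vacr -[J b in LHS]np_vacr.
exact: np_jA_comm.
Qed.

(** Stated through products with functions, so that the same rules serve [L x] and the right
    currents. *)
Definition current u (xi : der A) : Prop :=
  [/\ wt 1 u, forall a, np 0 u (J a) = J (xi a) &
      forall a (j : nat), (1 <= j)%N -> np j%:Z u (J a) = 0].

Lemma current_jL x : current (L x) (iL x).
Proof.
split=> [|a|a j j1]; [exact: (rel_wt rel)|exact: (rel_gA rel)|exact: (rel_gA_ge1 rel)].
Qed.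

Section Current.
Variables (u : D) (xi : der A).
Hypothesis cu : current u xi.

Lemma current_jA a : np 0 (J a) u = - J (xi a).
Proof.
case: cu => wu u0 _; have au (j : nat) : (1 <= j)%N -> np j%:Z (J a) u = 0.
  by move=> j1; apply: (np_wt_large (rel_wtA rel a) wu).
have := @np_commutator _ D (-1) 0 (J a) u vac (fun j j2 => au j (ltnW j2)).
rewrite (au 1%N) // np0l scaler0 addr0 np_vacr (np_vacr_ge0 0%N) np0r sub0r u0.
by rewrite addr0 np_vacr => ->.
Qed.

(** The first term is the anomaly: for [v] a current it differentiates [xi b] once more, which is
    how the divergence enters. *)
Lemma current_act1 b v : np 1 u (act b v) = np 0 (J (xi b)) v + act b (np 1 u v).
Proof.
case: cu => wu u0 u1; have ub (j : nat) : (2 <= j)%N -> np j%:Z u (J b) = 0.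
  by move=> j2; apply: u1; apply: ltnW.
apply/eqP; rewrite -subr_eq; apply/eqP; rewrite /act np_commutator // u0.
by rewrite (u1 b 1%N) // np0l scaler0 addr0.
Qed.

Lemma current_act0 b v : np 0 u (act b v) = act (xi b) v + act b (np 0 u v).
Proof. by case: cu => _ u0 _; rewrite /act np0_derivation u0. Qed.

Lemma current_dfun0 c : np 0 u (dfun c) = dfun (xi c).
Proof.
case: cu => _ u0 _.
by rewrite /dfun /transl np0_derivation u0 (np_vacr_ge0 0%N) np0r addr0.
Qed.

Lemma current_dfun1 c : np 1 u (dfun c) = J (xi c).
Proof.
case: cu => wu u0 u1; have uc (j : nat) : (2 <= j)%N -> np j%:Z u (J c) = 0.
  by move=> j2; apply: u1; apply: ltnW.
have := @np_commutator _ D 1 (-2) u (J c) vac uc.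
rewrite u0 (u1 c 1%N) // np0l scaler0 addr0 (np_vacr_ge0 1%N) np0r subr0.
have -> : 1 - 2 = -1 :> int by [].
by rewrite np_vacr.
Qed.

Lemma current_form1 b c : np 1 u (act b (dfun c)) = J (b * xi c).
Proof. by rewrite current_act1 current_dfun1 act_jA (np_jA_dfun _ _ 0) add0r. Qed.

End Current.

Definition one_form w : Prop :=
  exists s : seq (A * A), w = \sum_(q <- s) act q.1 (dfun q.2).

Lemma one_form0 : one_form 0.
Proof. by exists [::]; rewrite big_nil. Qed.

Lemma one_formD w w' : one_form w -> one_form w' -> one_form (w + w').
Proof. by move=> [s ->] [t ->]; exists (s ++ t); rewrite big_cat. Qed.

Lemma one_form_act a w : one_form w -> one_form (act a w).
Proof.
move=> [s ->]; exists [seq (a * q.1, q.2) | q <- s].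
rewrite big_map (lin_sum (act_linr a)); apply: eq_bigr => q _.
by rewrite act_act_dfun.
Qed.

Lemma one_formB w w' : one_form w -> one_form w' -> one_form (w - w').
Proof.
move=> ww ww'; apply: one_formD => //; rewrite -scaleN1r -[w']act1.
by rewrite -(linZ (act_linl w')); apply: one_form_act.
Qed.

Lemma one_form_sum (K : Type) (r : seq K) (F : K -> D) :
  (forall k, one_form (F k)) -> one_form (\sum_(k <- r) F k).
Proof.
move=> oF; elim: r => [|k r IH]; rewrite (big_nil, big_cons); first exact: one_form0.
exact: one_formD.
Qed.

Lemma one_form_jA w a (j : nat) : one_form w -> np j%:Z (J a) w = 0.
Proof.
by move=> [s ->]; rewrite (lin_sum (np_linr _ _)) big1 // => q _; apply: np_jA_act.
Qed.

Lemma one_form_current0 u xi w : current u xi -> one_form w -> one_form (np 0 u w).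
Proof.
move=> cu [s ->]; rewrite (lin_sum (np_linr _ _)); apply: one_form_sum => q.
rewrite (current_act0 cu) (current_dfun0 cu); apply: one_formD.
  by exists [:: (xi q.1, q.2)]; rewrite big_seq1.
by exists [:: (q.1, xi q.2)]; rewrite big_seq1.
Qed.

Lemma wt_one_form w : one_form w -> wt 1 w.
Proof. by move=> [s ->]; apply: wt_sum => q; apply/wt_act/wt_dfun. Qed.

Lemma np_one_form_jA w a (j : nat) : one_form w -> np j%:Z w (J a) = 0.
Proof.
move=> ww; apply: np_skew_zero => i; exact: one_form_jA.
Qed.

Variable fr : 'I_n -> A.
Hypothesis frP : dual_coordinates fr.

(* The left invariant forms dual to the fields of the basis [e]. *)
Definition coframe (i : 'I_n) : D := left_coef G act dfun (fr i).

Lemma coframe_one_form i : one_form (coframe i).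
Proof.
by exists [seq (antipode G p.1, p.2) | p <- comul G (fr i)]; rewrite big_map.
Qed.

Lemma dfun_coframe c : dfun c = \sum_(i < n) act (iL e`_i c) (coframe i).
Proof.
apply: (frame_expansion frP) => [|||||].
- exact: act_linl.
- exact: act_linr.
- by move=> b; apply: act1.
- exact: act_act_dfun.
- exact: dfun_linear.
- exact: dfunM.
Qed.

Lemma current_coframe u xi i : current u xi ->
  np 1 u (coframe i) = J (\sum_(p <- comul G (fr i)) antipode G p.1 * xi p.2).
Proof.
move=> cu; rewrite (lin_sum (np_linr _ _)) (lin_sum (rel_linA rel)).
by apply: eq_bigr => p _; rewrite (current_form1 cu).
Qed.

Lemma jL_coframe x i : np 1 (L x) (coframe i) = J (coord e i x)%:A.
Proof.
by rewrite (current_coframe _ (current_jL x)) left_field_contraction (frP i).2.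
Qed.

(** The products with the [L x] are contractions, and those with the basis are the coefficients of
    [w] in the coframe. *)
Lemma one_form_detect w : one_form w -> (forall x, np 1 (L x) w = 0) -> w = 0.
Proof.
move=> [s wE] Lw.
have coef x : \sum_(q <- s) q.1 * iL x q.2 = 0.
  apply: (@jA_inj _ _ _ _ _ D); rewrite (lin0 (rel_linA rel)) -(Lw x) wE.
  rewrite (lin_sum (np_linr _ _)) (lin_sum (rel_linA rel)).
  by apply: eq_bigr => q _; rewrite (current_form1 (current_jL x)).
rewrite wE; transitivity (\sum_(q <- s) \sum_(i < n) act (q.1 * iL e`_i q.2) (coframe i)).
  apply: eq_bigr => q _; rewrite dfun_coframe (lin_sum (act_linr q.1)).
  apply: eq_bigr => i _; apply: act_act => j; apply: one_form_jA; exact: coframe_one_form.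
rewrite exchange_big big1 // => i _.
by rewrite -(lin_sum (act_linl (coframe i))) coef (lin0 (act_linl _)).
Qed.

(* The canonical projection of [v] is the vector field with components [h] in the
   frame of the left invariant fields of [e]. *)
Definition lifts (h : 'I_n -> A) v : Prop :=
  exists2 w, one_form w & v = \sum_(i < n) act (h i) (L e`_i) + w.

(** The difference is a one-form whose contractions with all left invariant fields vanish. *)
Lemma lifts_uniq (h h' : 'I_n -> A) v v' : h =1 h' -> lifts h v -> lifts h' v' ->
  (forall x, np 1 (L x) v = 0) -> (forall x, np 1 (L x) v' = 0) -> v = v'.
Proof.
move=> hh [w ww ->] [w' ww' ->] Lv Lv'.
have vE : \sum_(i < n) act (h i) (L e`_i) = \sum_(i < n) act (h' i) (L e`_i).
  by apply: eq_bigr => i _; rewrite hh.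
rewrite -vE in Lv' *; congr (_ + _); apply/eqP; rewrite -subr_eq0; apply/eqP.
apply: one_form_detect => [|x]; first exact: one_formB.
have E (T y : D) : np 1 (L x) (T + y) = 0 -> np 1 (L x) y = - np 1 (L x) T.
  by rewrite (linD (np_linr 1 (L x))) addrC => /eqP; rewrite addr_eq0 => /eqP.
by rewrite (linB (np_linr 1 (L x))) (E _ _ (Lv x)) (E _ _ (Lv' x)) subrr.
Qed.

Lemma act_jL_sum (s : seq (A * g)) : \sum_(p <- s) act p.1 (L p.2) =
  \sum_(i < n) act (\sum_(p <- s) coord e i p.2 *: p.1) (L e`_i).
Proof.
under [RHS]eq_bigr => i _ do rewrite (lin_sum (act_linl _)).
rewrite exchange_big; apply: eq_bigr => p _ /=.
rewrite {1}(vbasis_sum p.2) (lin_sum (rel_lin rel)) (lin_sum (act_linr _)).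
apply: eq_bigr => i _.
by rewrite (linZ (rel_lin rel)) (linZ (act_linr _)) (linZ (act_linl _)).
Qed.

Lemma lifts_current (h : 'I_n -> A) (xi : der A) v : lifts h v ->
  (forall f, xi f = \sum_(i < n) h i * iL e`_i f) -> current v xi.
Proof.
move=> [w ww ->] xiE.
have wT : wt 1 (\sum_(i < n) act (h i) (L e`_i)).
  by apply: wt_sum => i; apply/wt_act/(rel_wt rel).
have wv : wt 1 (\sum_(i < n) act (h i) (L e`_i) + w).
  by rewrite -[\sum_(i < n) _]scale1r; apply: wt_lin => //; apply: wt_one_form.
split=> // [a|a j j1]; last by apply: (np_wt_large wv (rel_wtA rel a)); rewrite addn0.
rewrite (linD (np_linl 0 (J a))) (np_one_form_jA a 0 ww) addr0.
rewrite (lin_sum (np_linl 0 (J a))) xiE (lin_sum (rel_linA rel)).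
apply: eq_bigr => i _; rewrite -act_jA -(rel_gA rel).
apply: (@np_assoc_nonneg _ D (-1) 0) => j; first exact: (rel_AA_ge0 rel).
exact: (rel_gA_ge1 rel).
Qed.

End WeightOne.

(** * The right embedding *)

Section RightCurrents.
Variables (C : fieldType) (A : comAlgType C) (G : groupScheme A) (g : lieAlgebra G).
Variables (B : g -> g -> C) (D : cdo B).
Hypothesis hB : invariant_form B.
Local Notation n := (\dim {:g}).
Local Notation e := (vbasis {:g}).
Local Notation J := (jA D).
Local Notation L := (jL D).
Variable fr : 'I_n -> A.
Hypothesis frP : dual_coordinates fr.
Local Notation adj := (adj fr).
Local Notation coframe := (coframe D fr).
Local Notation beta := (dual_form B).
Implicit Types (x y z : g).

Let rel := cdo_rel D.
Let hbeta := dual_form_invariant hB.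

(* The contraction of the one-form part of the right current of [x] with the
   left invariant field of [z]. *)
Definition correction x z : A := \sum_(l < n) beta z e`_l *: adj x l.

Definition right_current x : D := \sum_(i < n) act (adj x i) (L e`_i)
  + \sum_(i < n) act (correction x e`_i) (coframe i).

Lemma correction_linl z : linear (correction^~ z).
Proof.
move=> k x y; rewrite /correction scaler_sumr -big_split; apply: eq_bigr => l _ /=.
by rewrite adj_linear scalerDr !scalerA mulrC.
Qed.

Lemma correction_linr x : linear (correction x).
Proof.
move=> k y z; rewrite /correction scaler_sumr -big_split; apply: eq_bigr => l _ /=.
by rewrite (form_linl hbeta) scalerDl scalerA.
Qed.

Lemma right_current_linear : linear right_current.
Proof.
move=> k x y; rewrite /right_current scalerDr addrACA !scaler_sumr -!big_split.
apply: eq_bigr => i _ /=.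
by rewrite adj_linear correction_linl !act_linl.
Qed.

Lemma right_current_lifts x : lifts (adj x) (right_current x).
Proof.
exists (\sum_(i < n) act (correction x e`_i) (coframe i)) => //.
by apply: one_form_sum => i; apply/one_form_act/coframe_one_form.
Qed.

Lemma current_right x : current (right_current x) (iR x).
Proof.
apply: (lifts_current (right_current_lifts x)) => f; exact: right_field_frame.
Qed.

(** [left_adj] brackets the basis vectors with [y], and invariance of [beta] carries the bracket
    over to [z]. *)
Lemma left_correction x y z : iL y (correction x z) = correction x (br y z).
Proof.
rewrite /correction der_sum.
transitivity (- \sum_(k < n) beta z (br y e`_k) *: adj x k).
  under eq_bigr => l _ do rewrite derZ left_adj // scalerN scaler_sumr.
  rewrite sumrN exchange_big; congr (- _); apply: eq_bigr => k _ /=.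
  rewrite [in RHS](vbasis_sum (br y e`_k)).
  rewrite (form_sumr _ _ _ _ hbeta) scaler_suml; apply: eq_bigr => l _.
  by rewrite scalerA mulrC.
rewrite -sumrN; apply: eq_bigr => k _; rewrite -scaleNr; congr (_ *: _).
rewrite -(form_inv hbeta) [br y z]br_anti -[- br z y]addr0 -scaleN1r.
rewrite (form_linl hbeta) mulN1r.
have := form_linl hbeta 1 0 0 e`_k; rewrite scale1r mul1r addr0.
by rewrite -[in X in X = _](addr0 (beta 0 _)) => /addrI <-; rewrite addr0.
Qed.

(** Two uses of [left_adj] compose the adjoint actions of [y] and [e_l], and the sum over [i] takes
    the trace. This is the source of the Killing form. *)
Lemma divergence_left_adj x y :
  \sum_(i < n) iL e`_i (iL y (adj x i)) = - \sum_(l < n) killing y e`_l *: adj x l.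
Proof.
transitivity (\sum_(i < n) \sum_(k < n) \sum_(l < n)
    (coord e i (br y e`_k) * coord e k (br e`_i e`_l)) *: adj x l).
  apply: eq_bigr => i _; rewrite left_adj //.
  rewrite (linN (@der_fun_linear _ _ _)) der_sum -sumrN.
  apply: eq_bigr => k _; rewrite derZ left_adj // scalerN opprK scaler_sumr.
  by apply: eq_bigr => l _; rewrite scalerA.
under eq_bigr => i _ do rewrite exchange_big.
rewrite exchange_big -sumrN; apply: eq_bigr => l _ /=; rewrite -scaleNr.
under eq_bigr => i _ do rewrite -scaler_suml.
rewrite -scaler_suml; congr (_ *: _); rewrite /killing -sumrN; apply: eq_bigr => i _.
rewrite [br e`_l _]br_anti (linN (br_linr y)) linearN opprK.
rewrite {2}(vbasis_sum (br e`_i e`_l)) (lin_sum (br_linr y)) linear_sum.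
by apply: eq_bigr => k _; rewrite (linZ (br_linr y)) linearZ mulrC.
Qed.

Lemma jL_correction x z :
  np 1 (L z) (\sum_(i < n) act (correction x e`_i) (coframe i)) = J (correction x z).
Proof.
rewrite (lin_sum (np_linr 1 (L z))).
under eq_bigr => i _ do rewrite (current_act1 (current_jL D z))
  (one_form_jA _ 0 (coframe_one_form D fr i)) add0r jL_coframe // act_jA
  [correction x _ * _]mulrC mulr_algl.
rewrite -(lin_sum (rel_linA rel)); congr (J _).
rewrite [in RHS](vbasis_sum z) (lin_sum (correction_linr x)).
by apply: eq_bigr => i _; rewrite (linZ (correction_linr x)).
Qed.

(** The vector part contributes the Killing form from the divergence and [B] from the pairing of
    generators; [correction] is chosen to cancel both. *)
Lemma jL_right1 x y : np 1 (L y) (right_current x) = 0.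
Proof.
have cL := current_jL D y.
rewrite (linD (np_linr 1 (L y))) jL_correction (lin_sum (np_linr 1 (L y))).
under eq_bigr => i _ do rewrite (current_act1 cL) (current_jA (current_jL D e`_i))
  (rel_gg1 rel) -jA_scalar act_jA [adj x i * _]mulrC mulr_algl.
rewrite big_split /= sumrN -!(lin_sum (rel_linA rel)).
rewrite -(linN (rel_linA rel)) -!(linD (rel_linA rel)) -[RHS](lin0 (rel_linA rel)).
congr (J _).
rewrite (divergence_left_adj x y) opprK /correction -!big_split big1 // => l _ /=.
rewrite -!scalerDl; set k := (X in X *: _); suff -> : k = 0 by rewrite scale0r.
by rewrite /k /dual_form; ring.
Qed.

(** On the vector part this is [left_adj]. The rest is a one-form, whose contraction with [z] is the
    difference of the two sides of [left_correction]. *)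
Lemma jL_right0 x y : np 0 (L y) (right_current x) = 0.
Proof.
have cL := current_jL D y.
set w := \sum_(i < n) act (correction x e`_i) (coframe i).
have ww : one_form w.
  by apply: one_form_sum => i; apply/one_form_act/coframe_one_form.
rewrite (linD (np_linr 0 (L y))) -/w.
have -> : np 0 (L y) (\sum_(i < n) act (adj x i) (L e`_i)) = 0.
  rewrite (lin_sum (np_linr 0 (L y))).
  under eq_bigr => i _ do rewrite (current_act0 cL) (rel_gg0 rel).
  rewrite big_split /= -(big_map (fun k => (adj x k, br y e`_k)) xpredT
    (fun p => act p.1 (L p.2))) act_jL_sum -big_split big1 // => i _ /=.
  rewrite big_map -(linD (act_linl _)) -[left_field _ _ _]/(iL y (adj x i)).
  by rewrite left_adj // addNr (lin0 (act_linl _)).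
rewrite add0r; apply: (one_form_detect frP) => [|z]; first exact: one_form_current0 cL ww.
have := np0_derivation 1 (L y) (L z) w.
rewrite (rel_gg0 rel) !jL_correction (rel_gA rel).
by rewrite (left_correction x y z) -[in X in X = _](addr0 (J _)) => /addrI <-.
Qed.

Lemma jL_right x y (j : nat) : np j%:Z (L y) (right_current x) = 0.
Proof.
case: j => [|[|j]]; [exact: jL_right0|exact: jL_right1|].
have [wr _ _] := current_right x; exact: (np_wt_large (rel_wt rel y) wr).
Qed.

Lemma right_jL x y (j : nat) : np j%:Z (right_current x) (L y) = 0.
Proof. by apply: np_skew_zero => i; apply: jL_right. Qed.

Lemma right_right0 x y :
  np 0 (right_current x) (right_current y) = right_current (br x y).
Proof.
have cR := current_right x.
apply: (@lifts_uniq _ _ _ _ _ _ _ frP (fun i => iR x (adj y i)) (adj (br x y))).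
- by move=> i; apply: right_adj.
- have [w ww ->] := right_current_lifts y; exists (np 0 (right_current x) w).
    exact: one_form_current0 cR ww.
  rewrite (linD (np_linr 0 _)) (lin_sum (np_linr 0 _)); congr (_ + _).
  apply: eq_bigr => i _; rewrite (current_act0 cR) (right_jL x e`_i 0).
  by rewrite (lin0 (act_linr _)) addr0.
- exact: right_current_lifts.
- move=> z; have := np0_derivation 1 (right_current x) (L z) (right_current y).
  rewrite (jL_right y z 1) (right_jL x z 0) np0r np0l add0r.
  by move=> <-.
- by move=> z; apply: (jL_right _ z 1).
Qed.

(** The first summand contracts the one-form part of the current of [y] with [iR x]; the second is
    the anomaly of its vector part, rewritten by [right_adj]. *)
Definition right_pairing x y : A :=
  \sum_(i < n) (correction y e`_i * adj x i - iL e`_i (adj (br x y) i)).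

Lemma right_right1 x y :
  np 1 (right_current x) (right_current y) = J (right_pairing x y).
Proof.
have cR := current_right x.
rewrite {2}/right_current (linD (np_linr 1 _)) !(lin_sum (np_linr 1 _)).
rewrite /right_pairing (lin_sum (rel_linA rel)) addrC -big_split.
apply: eq_bigr => i _ /=; rewrite !(current_act1 cR) (right_jL x e`_i 1).
rewrite (lin0 (act_linr _)) addr0 (current_jA (current_jL D e`_i)).
rewrite (one_form_jA _ 0 (coframe_one_form D fr i)) add0r (current_coframe _ _ cR) act_jA.
by rewrite -(linN (rel_linA rel)) -(linD (rel_linA rel)) -right_adj.
Qed.

(** The product by [L z] of index 0 is a derivation that kills both right currents. *)
Lemma right_pairing_left_const x y : left_const g (right_pairing x y).
Proof.
move=> z; apply: (@jA_inj _ _ _ _ _ D); rewrite (lin0 (rel_linA rel)) -(rel_gA rel).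
rewrite -right_right1 np0_derivation (jL_right x z 0) (jL_right y z 0).
by rewrite np0l np0r addr0.
Qed.

(** At 1 the first summands give [beta x y], and the divergence becomes the trace of the adjoint
    action of a bracket, which is 0. *)
Lemma counit_right_pairing x y : (counit G (right_pairing x y) : C) = beta x y.
Proof.
have cD (s : seq 'I_n) (F : 'I_n -> A) : (counit G (\sum_(i <- s) F i) : C) =
    \sum_(i <- s) (counit G (F i) : C) by apply: (rmorph_sum (counit G)).
have cZ k a : (counit G (k *: a) : C) = k * (counit G a : C).
  by rewrite linearZ.
have cB a b : (counit G (a - b) : C) = (counit G a : C) - (counit G b : C).
  by rewrite linearB.
have cC z : (counit G (correction y z) : C) = - beta z y.
  rewrite /correction cD {2}(vbasis_sum y) (form_sumr _ _ _ _ hbeta) -sumrN; apply: eq_bigr => l _.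
  by rewrite cZ counit_adj // mulrN mulrC.
rewrite /right_pairing cD.
under eq_bigr => i _ do rewrite cB counitM cC counit_adj // mulrNN.
rewrite sumrB.
have -> : \sum_(i < n) beta e`_i y * coord e i x = beta x y.
  rewrite {2}(vbasis_sum x) (form_sym hbeta) (form_sumr _ _ _ _ hbeta); apply: eq_bigr => i _.
  by rewrite mulrC (form_sym hbeta).
suff -> : \sum_(i < n) (counit G (iL e`_i (adj (br x y) i)) : C) = 0 by rewrite subr0.
transitivity (- endo_trace (br (br x y))); last by rewrite trace_ad_br oppr0.
rewrite -sumrN; apply: eq_bigr => i _.
rewrite left_adj // -scaleN1r cZ cD mulN1r; congr (- _).
rewrite [br (br x y) _]br_anti linearN [in RHS](vbasis_sum (br x y)).
rewrite (lin_sum (br_linr _)) linear_sum -sumrN.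
apply: eq_bigr => k _; rewrite cZ counit_adj // (linZ (br_linr _)) linearZ.
by rewrite mulrN mulrC.
Qed.

End RightCurrents.

Theorem theorem2p5 (R : realType) (A : comAlgType R[i]) (G : groupScheme A)
    (hsmooth : smooth A) (hconn : spec_connected A)
    (g : lieAlgebra G) (Om : kaehler A)
    (B : g -> g -> R[i]) (hB : invariant_form B) (D : cdo B) :
  (exists jR : {linear g -> D}, is_jR Om jR /\
     forall jR' : {linear g -> D}, is_jR Om jR' -> jR' =1 jR) /\
  (forall jR : {linear g -> D}, is_jR Om jR -> forall x y : g,
     np 1 (jR x) (jR y) = dual_form B x y *: vac /\
     np 0 (jR x) (jR y) = jR (br x y)).
Proof.
have [fr frP] := dual_coordinates_exist g.
pose r := right_current D fr.
pose rL := GRing.isLinear.Build _ _ _ *:%R r (right_current_linear D fr).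
pose jR : {linear g -> D} := HB.pack r rL.
(* Condition (a) fixes the components in the frame by [frame_uniq], and the product of index 1 in
   (b) then fixes the one-form. *)
have uniq (jR' : {linear g -> D}) : is_jR Om jR' -> jR' =1 r.
  case=> _ _ proj comm x; have [om [s [w [jE xiE _]]]] := proj x.
  apply: (@lifts_uniq _ _ _ _ _ _ _ frP
    (fun i => \sum_(p <- s) coord (vbasis {:g}) i p.2 *: p.1) (adj fr x)).
  - apply: (frame_uniq frP) => f; rewrite -right_field_frame // xiE.
    under eq_bigr => i _ do rewrite mulr_suml.
    rewrite exchange_big; apply: eq_bigr => p _ /=.
    rewrite -[left_field _ _ _]/(iL p.2 f) left_field_basis mulr_sumr.
    by apply: eq_bigr => i _; rewrite -scalerAl -scalerAr.
  - rewrite jE act_jL_sum; exists (\sum_(q <- w) act q.1 (dfun D q.2)) => //.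
    by exists w.
  - exact: right_current_lifts.
  - by move=> z; apply: (comm z x 1%N).
  - by move=> z; apply: (jL_right D hB frP x z 1).
split; last first.
  move=> jR' /uniq jR'E x y; rewrite !jR'E; split; last exact: right_right0.
  rewrite /r right_right1 // (@left_const_constant _ _ _ g _ (right_pairing B fr x y)).
  - by rewrite counit_right_pairing // jA_scalar.
  - by move=> k; rewrite Num.Theory.pnatr_eq0.
  - by case: hsmooth.
  - exact: hconn.
  - exact: (right_pairing_left_const D hB frP).
have projR x : canonical_proj Om (jR x) (iR x).
  have [w [t wE] rE] := right_current_lifts D fr x.
  exists (\sum_(q <- t) q.1 *: kd Om q.2).
  exists [seq (adj fr x i, (vbasis {:g})`_i) | i : 'I_(\dim {:g})], t; split=> //.
    by rewrite big_image -wE; apply: rE.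
  by move=> f; rewrite big_image (right_field_frame frP).
exists jR; split; last exact: uniq.
split=> // [x y xy|x|x y j].
(* Equal currents have equal projections, so [iR x] and [iR y] agree, and their values at 1 give
   [x = y]. *)
- apply: tangent_inj => f; apply: oppr_inj; rewrite -!counit_right_field.
  congr (counit G _); apply: canonical_proj_uniq (projR x) _ f.
  by rewrite xy.
- by have [] := current_right D frP x.
- exact: jL_right.
Qed.
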